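(* Let $\bar A=(A_0,A_1)$ be a compatible couple of (quasi-)Banach spaces with $A_0\cap A_1\neq\{0\}$. Let $0<\theta,\theta_1<1$, $0<q_1,r_0,r_1,r\le\infty$, $a,a_1,b_0,b_1\in SV$, $\left\|s^{-1/r_1}\frac{b_1(s)}{a_1(s)}\right\|_{r_1,(0,1)}<\infty$, and $\left\|s^{-1/r_0}b_0(s)\right\|_{r_0,(1,\infty)}<\infty$. Put $c_0(t)=\left\|s^{-1/r_0}b_0(s)\right\|_{r_0,(t,\infty)}$, $c_1(t)=a_1(t)\left\|s^{-1/r_1}\frac{b_1(s)}{a_1(s)}\right\|_{r_1,(0,t)}$, and $\rho(t)=t^{\theta_1}\frac{c_0(t)}{c_1(t)}$ for $t>0$. Then $$\left(\bar A_{0,r_0,b_0},\bar A^{\mathcal R}_{\theta_1,r_1,b_1,q_1,a_1}\right)_{\theta,r,a}\cong\bar A_{\eta,r,a^{\#}},$$ where $\eta=\theta\theta_1$ and $a^{\#}(t)=c_0(t)^{1-\theta}c_1(t)^{\theta}a(\rho(t))$.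
   Context: For a compatible couple $\bar X=(X_0,X_1)$ of (quasi-)Banach spaces, $f\in X_0+X_1$ and $t>0$, $K(t,f)=K(t,f;\bar X)=\inf\{\|f_0\|_{X_0}+t\|f_1\|_{X_1}: f=f_0+f_1,\ f_i\in X_i\}$. $\|\cdot\|_{q,(c,d)}$ ($0<q\le\infty$) is the usual (quasi-)norm of the Lebesgue space $L_q$ on the interval $(c,d)$ with Lebesgue measure (variable of integration: the displayed variable; $1/\infty=0$). $SV$ is the set of positive Lebesgue measurable functions $b$ on $(0,\infty)$ that are slowly varying: for each $\varepsilon>0$, $t^{\varepsilon}b(t)$ is equivalent to an increasing function and $t^{-\varepsilon}b(t)$ is equivalent to a decreasing function, where two positive functions are equivalent if each is bounded by a constant multiple of the other. For $0\le\theta\le1$, $0<q\le\infty$, $b\in SV$, $\bar X_{\theta,q,b}=(X_0,X_1)_{\theta,q,b}$ is the space of $f\in X_0+X_1$ with $\|f\|=\left\|u^{-\theta-1/q}b(u)K(u,f)\right\|_{q,(0,\infty)}<\infty$. For $0<\sigma<1$, $0<r,q\le\infty$, $a,b\in SV$, $\bar X^{\mathcal R}_{\sigma,r,b,q,a}$ is the space of $f\in X_0+X_1$ with $\|f\|=\left\|t^{-1/r}\frac{b(t)}{a(t)}\left\|u^{-\sigma-1/q}a(u)K(u,f)\right\|_{q,(t,\infty)}\right\|_{r,(0,\infty)}<\infty$. $X\cong Y$ means that $X$ and $Y$ are continuously embedded in each other (same space, equivalent quasi-norms). *)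

(* Defs.v *)
From HB Require Import structures.
From mathcomp Require Import all_boot all_order all_algebra.
From mathcomp Require Import all_classical all_reals all_analysis.

Set Implicit Arguments.
Unset Strict Implicit.
Unset Printing Implicit Defensive.

Import Order.TTheory GRing.Theory Num.Theory.
Import numFieldNormedType.Exports.

Local Open Scope classical_set_scope.
Local Open Scope ring_scope.

(* A (quasi-)normed space sitting inside an ambient real vector space V.  Only
   the values of [qnorm] on [carrier] are meaningful.  Complex spaces are
   covered by restriction of scalars: the K-functional and the interpolation
   spaces only use addition and the quasi-norms. *)
Record qnspace (R : realType) (V : Type) :=
  QNSpace { carrier : set V ; qnorm : V -> R }.

Section Couples.
Context {R : realType} {V : topologicalLmodType R}.
Implicit Types X Y : qnspace R V.

Definition subspace X :=
  [/\ carrier X 0,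
      forall x y, carrier X x -> carrier X y -> carrier X (x + y) &
      forall (k : R) x, carrier X x -> carrier X (k *: x)].

Definition quasi_norm X :=
  [/\ forall x, carrier X x -> 0 <= qnorm X x,
      forall x, carrier X x -> qnorm X x = 0 -> x = 0,
      forall (k : R) x, carrier X x -> qnorm X (k *: x) = `|k| * qnorm X x &
      exists C : R, forall x y, carrier X x -> carrier X y ->
        qnorm X (x + y) <= C * (qnorm X x + qnorm X y)].

Definition qcomplete X :=
  forall x : nat -> V, (forall n, carrier X (x n)) ->
    (forall e : R, 0 < e -> exists N : nat, forall m n : nat,
      (N <= m)%N -> (N <= n)%N -> qnorm X (x m - x n) < e) ->
    exists2 l : V, carrier X l & qnorm X (x n - l) @[n --> \oo] --> (0 : R).

Definition quasi_banach X := [/\ subspace X, quasi_norm X & qcomplete X].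

(* The inclusion is linear, so its continuity is continuity at 0. *)
Definition embedded_in_ambient X :=
  forall U : set V, nbhs (0 : V) U ->
    exists2 d : R, 0 < d & forall x, carrier X x -> qnorm X x < d -> U x.

Definition compatible_couple X0 X1 :=
  [/\ hausdorff_space V, quasi_banach X0, quasi_banach X1,
      embedded_in_ambient X0 & embedded_in_ambient X1].

Definition sum_carrier X0 X1 : set V :=
  [set f | exists f0 f1, [/\ carrier X0 f0, carrier X1 f1 & f = f0 + f1]].

Definition Kfun X0 X1 (t : R) (f : V) : R :=
  inf [set s | exists f0 f1, [/\ carrier X0 f0, carrier X1 f1, f = f0 + f1 &
                               s = qnorm X0 f0 + t * qnorm X1 f1]].

Definition qn_embedded X Y :=
  carrier X `<=` carrier Y /\
  exists C : R, forall f, carrier X f -> qnorm Y f <= C * qnorm X f.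

Definition qn_equivalent X Y := qn_embedded X Y /\ qn_embedded Y X.

End Couples.

(* [completed_lebesgue_measure] lives on the sigma-algebra of all Lebesgue
   measurable sets, not only the Borel ones.  The function is extended by 0
   outside D. *)
Definition Lqnorm {R : realType} (q : \bar R) (D : set R) (f : R -> \bar R)
    : \bar R :=
  Lnorm (@completed_lebesgue_measure R) q (f \_ D).

(* 1/q for 0 < q <= +oo, with 1/+oo = 0 *)
Definition rcp {R : realType} (q : \bar R) : R := fine (q^-1)%E.

Section SlowlyVarying.
Context {R : realType}.
Implicit Types b g h : R -> R.

Definition positive_fun g := forall t, 0 < t -> 0 < g t.

Definition equivalent_fun g h :=
  exists C : R, forall t, 0 < t -> g t <= C * h t /\ h t <= C * g t.

Definition lebesgue_measurable_fun b :=
  measurable_fun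
    (`]0, +oo[%classic : set (caratheodory_type ((wlength idfun)^*)%mu))
    (b : _ -> measurableTypeR R).

Definition slowly_varying b :=
  [/\ positive_fun b, lebesgue_measurable_fun b &
   forall e : R, 0 < e ->
    (exists g, [/\ positive_fun g,
       {in `]0, +oo[ &, {homo g : x y / x <= y}} &
       equivalent_fun (fun t => t `^ e * b t) g]) /\
    (exists h, [/\ positive_fun h,
       {in `]0, +oo[ &, {homo h : x y /~ x <= y}} &
       equivalent_fun (fun t => t `^ (- e) * b t) h])].

End SlowlyVarying.

Section InterpolationSpaces.
Context {R : realType} {V : topologicalLmodType R}.
Implicit Types X : qnspace R V.

Definition interp_norm X0 X1 (theta : R) (q : \bar R) (b : R -> R) (f : V)
    : \bar R :=
  Lqnorm q `]0, +oo[
    (fun u => (u `^ (- theta - rcp q) * b u * Kfun X0 X1 u f)%:E).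

Definition interp X0 X1 (theta : R) (q : \bar R) (b : R -> R) : qnspace R V :=
  QNSpace
    [set f | sum_carrier X0 X1 f /\ (interp_norm X0 X1 theta q b f < +oo)%E]
    (fun f => fine (interp_norm X0 X1 theta q b f)).

(* The inner norm may be +oo, hence the product in \bar R; its left factor is
   positive, so the convention 0 * +oo = 0 plays no role. *)
Definition interpR_norm X0 X1 (sigma : R) (r : \bar R) (b : R -> R)
    (q : \bar R) (a : R -> R) (f : V) : \bar R :=
  Lqnorm r `]0, +oo[
    (fun t => (t `^ (- rcp r) * (b t / a t))%:E *
       Lqnorm q `]t, +oo[
         (fun u => (u `^ (- sigma - rcp q) * a u * Kfun X0 X1 u f)%:E))%E.

Definition interpR X0 X1 (sigma : R) (r : \bar R) (b : R -> R)
    (q : \bar R) (a : R -> R) : qnspace R V :=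
  QNSpace
    [set f | sum_carrier X0 X1 f /\
             (interpR_norm X0 X1 sigma r b q a f < +oo)%E]
    (fun f => fine (interpR_norm X0 X1 sigma r b q a f)).

End InterpolationSpaces.

(* Main.v *)
(* Slowly varying functions are handled through their logarithms: b is slow
   when |ln b(s) - ln b(t)| <= C + e |ln s - ln t| for every e > 0.  All norms
   of L_q(dt/t) are compared with the l_q norm of the suprema over the blocks
   [e^k, e^(k+1)[; this replaces every measurability and change of variable
   argument, because K-functionals, slow functions and rho vary by at most a
   constant factor on a block.

   With Y0, Y1 the two spaces on the left, K_Y their K-functional and
   w = rho^(-theta) (a o rho), the weight of the right-hand space is
   t^(-eta) a#(t) = w(t) c0(t).

   Lower bound: c0(t) K(t, f) <= C K_Y(rho(t), f), since restricting the norms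
   of Y0 to (t, oo) and of Y1 to (0, t) gives c0(t) K(t, f0) <= C |f0|_Y0 and
   c0(t) K(t, f1) <= C rho(t) |f1|_Y1.  The change of variable u = rho(t) is
   an instance of Schur's test in l_q.

   Upper bound: put G = w c0 K(., f).  Split f = f0 + f1 almost optimally for
   K(t, f).  If B bounds e^(-d |ln s - ln t|) G(s) for all s, then
   w(t) |f0|_Y0 and w(t) rho(t) |f1|_Y1 are at most C B: away from t every
   integrand decays geometrically, and the remaining pieces are c0(t) K(t, f)
   and c1(t) t^(-theta1) K(t, f).  Hence w(t) K_Y(rho(t), f) is at most
   C sup_s e^(-d |ln s - ln t|) G(s), and Schur's test applies for all q > 0,
   a supremum being at most an l_q norm. *)

Require Import Defs.
From mathcomp Require Import all_boot all_order all_algebra.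
From mathcomp Require Import all_classical all_reals all_analysis.
From mathcomp Require Import ess_sup_inf ring lra.

Set Implicit Arguments.
Unset Strict Implicit.
Unset Printing Implicit Defensive.

Import Order.TTheory GRing.Theory Num.Theory.
Import numFieldNormedType.Exports.

Local Open Scope classical_set_scope.
Local Open Scope ring_scope.

(** * l_q norms over the integers *)

Section ExtendedPowers.
Context {R : realType}.
Local Open Scope ereal_scope.

Lemma le_poweR (p : R) (x y : \bar R) : (0 < p)%R -> 0 <= x -> x <= y ->
  x `^ p <= y `^ p.
Proof.
move=> p0 x0 xy; apply: gt0_ler_poweR => //; first exact: ltW.
  by rewrite in_itv/= x0 leey.
by rewrite in_itv/= (le_trans x0 xy) leey.
Qed.

Lemma poweRK (p : R) (x : \bar R) : (0 < p)%R -> 0 <= x ->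
  (x `^ p) `^ p^-1 = x.
Proof. by move=> p0 x0; rewrite -poweRrM mulfV ?gt_eqF// poweRe1. Qed.

Lemma poweRVK (p : R) (x : \bar R) : (0 < p)%R -> 0 <= x ->
  (x `^ p^-1) `^ p = x.
Proof. by move=> p0 x0; rewrite -poweRrM mulVf ?gt_eqF// poweRe1. Qed.

Lemma poweRV_le (p : R) (x y : \bar R) : (0 < p)%R -> 0 <= x -> 0 <= y ->
  (x `^ p^-1 <= y) = (x <= y `^ p).
Proof.
move=> p0 x0 y0; apply/idP/idP => h.
  by rewrite -(poweRVK p0 x0); apply: le_poweR => //; exact: poweR_ge0.
by rewrite -(poweRK p0 y0); apply: le_poweR; rewrite ?invr_gt0.
Qed.

End ExtendedPowers.

(** * The l_q norm over the integers for 0 < q <= oo *)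

Section SequenceNorm.
Context {R : realType}.
Local Open Scope ereal_scope.
Implicit Types (q B : \bar R) (x y z : int -> \bar R).

(** [esum] is an unordered sum, so two-sided families need no enumeration and the norm may be
    infinite. *)
Definition lq q x : \bar R :=
  match q with
  | p%:E => (\esum_(k in [set: int]) x k `^ p) `^ p^-1
  | +oo => ereal_sup (range x)
  | -oo => 0
  end.

Lemma lq_ge0 q x : (forall k, 0 <= x k) -> 0 <= lq q x.
Proof.
move=> x0; case: q => [p||] //=; first exact: poweR_ge0.
by apply: le_trans (x0 0%R) _; apply: ereal_sup_ubound; exists 0%R.
Qed.

Lemma esum_powR_ge0 (p : R) x : 0 <= \esum_(k in [set: int]) x k `^ p.
Proof. by apply: esum_ge0 => k _; exact: poweR_ge0. Qed.
Hint Resolve esum_powR_ge0 : core.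

Lemma lq_le_fin (p : R) x B : (0 < p)%R -> 0 <= B ->
  (lq p%:E x <= B) = (\esum_(k in [set: int]) x k `^ p <= B `^ p).
Proof. by move=> p0 B0; rewrite /= poweRV_le. Qed.

Lemma lq_le_pinfty x B : lq +oo x <= B <-> forall k, x k <= B.
Proof.
split=> [h k|h]; first by apply: le_trans h; apply: ereal_sup_ubound; exists k.
by apply: ge_ereal_sup => _ [k _ <-].
Qed.

Lemma lq_pinfty_ub x k : x k <= lq +oo x.
Proof. by have /lq_le_pinfty := lexx (lq +oo x); apply. Qed.

Lemma lq_mono q x y : 0 < q -> (forall k, 0 <= x k) ->
  (forall k, x k <= y k) -> lq q x <= lq q y.
Proof.
move=> + x0 xy; have y0 k : 0 <= y k by exact: le_trans (xy k).
case: q => [p p0|_|//]; last first.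
  apply/lq_le_pinfty => k; apply: le_trans (xy k) _.
  exact: lq_pinfty_ub.
apply: le_poweR => //; first by rewrite invr_gt0.
by apply: le_esum => k _; exact: le_poweR.
Qed.

Lemma lq_pt q x k : 0 < q -> (forall k, 0 <= x k) -> x k <= lq q x.
Proof.
case: q => [p p0|_|//] x0; last exact: lq_pinfty_ub.
rewrite -[leLHS](poweRK p0)//; apply: le_poweR; rewrite ?invr_gt0//.
  exact: poweR_ge0.
apply: esum_ge; exists [set k]; first by split.
by rewrite fsbig_set1.
Qed.

Lemma esumZl (T : choiceType) (c : \bar R) (a : T -> \bar R) :
  0 <= c -> (forall k, 0 <= a k) ->
  \esum_(k in [set: T]) (c * a k) <= c * \esum_(k in [set: T]) a k.
Proof.
move=> c0 a0; apply: ge_ereal_sup => _ [X [finX XI] <-].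
rewrite -ge0_mule_fsumr//; apply: lee_wpmul2l => //.
by apply: esum_ge; exists X.
Qed.

Lemma lq_scale q (c : \bar R) x : 0 < q -> 0 <= c -> (forall k, 0 <= x k) ->
  lq q (fun k => c * x k) <= c * lq q x.
Proof.
case: q => [p p0|_|//] c0 x0; last first.
  apply/lq_le_pinfty => k; apply: lee_wpmul2l => //.
  exact: lq_pinfty_ub.
have h0 : 0 <= c * lq p%:E x by rewrite mule_ge0// lq_ge0.
rewrite lq_le_fin// poweRM ?lq_ge0//= poweRVK//.
apply: le_trans (esumZl _ _); rewrite ?poweR_ge0//.
  by apply: le_esum => k _; rewrite poweRM.
by move=> k; exact: poweR_ge0.
Qed.

(** For finite q the p-th power of [x k] is at most the sum of those of [y k] and [z k], whence the
    constant 2^(1/p). This serves for integrands bounded in different ways on the two sides of a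
    point. *)
Lemma lq_max q : 0 < q -> exists2 C : R, (0 < C)%R & forall x y z B, 0 <= B ->
  (forall k, 0 <= x k) -> (forall k, 0 <= y k) -> (forall k, 0 <= z k) ->
  (forall k, x k <= y k \/ x k <= z k) ->
  lq q y <= B -> lq q z <= B -> lq q x <= C%:E * B.
Proof.
case: q => [p p0|_|//]; last first.
  exists 1%R => // x y z B B0 x0 y0 z0 h hy hz; rewrite mul1e.
  apply/lq_le_pinfty => k; have /lq_le_pinfty/(_ k) := hy.
  by have /lq_le_pinfty/(_ k) := hz; case: (h k) => + ? ? => /le_trans; apply.
exists (2 `^ p^-1)%R; first by rewrite powR_gt0.
move=> x y z B B0 x0 y0 z0 h hy hz.
rewrite lte_fin in p0.
rewrite lq_le_fin//; last by rewrite mule_ge0 ?lee_fin ?powR_ge0.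
rewrite poweRM ?lee_fin ?powR_ge0// -poweR_EFin poweRVK//.
move: hy hz; rewrite !lq_le_fin// => hy hz.
have -> : 2%:E * B `^ p = B `^ p + B `^ p.
  by rewrite -mule2n -mule_natl.
apply: le_trans (leeD hy hz); rewrite -esumD => [|k _|k _]; rewrite ?poweR_ge0//.
apply: le_esum => k _; case: (h k) => hk.
  by apply: le_trans (le_poweR p0 (x0 k) hk) _; rewrite leeDl// poweR_ge0.
by apply: le_trans (le_poweR p0 (x0 k) hk) _; rewrite leeDr// poweR_ge0.
Qed.

Lemma esum_interchange (S T : choiceType) (a : S -> T -> \bar R) :
  (forall i j, 0 <= a i j) ->
  \esum_(i in [set: S]) \esum_(j in [set: T]) a i j =
  \esum_(j in [set: T]) \esum_(i in [set: S]) a i j.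
Proof.
move=> a0; rewrite !esum_esum//.
rewrite (reindex_esum ([set: T] `*`` (fun=> [set: S])) _ (fun u => (u.2, u.1)))//.
split=> //=; first by move=> [i j] [j' i'] _ _ [-> ->].
by move=> [i j] _; exists (j, i).
Qed.

Lemma geometric_esum_le (z : R) : (0 < z < 1)%R ->
  \esum_(n in [set: nat]) (z ^+ n)%:E <= ((1 - z)^-1)%:E.
Proof.
move=> /andP[z0 z1]; rewrite -nneseries_esumT => [|n]; last first.
  by rewrite lee_fin exprn_ge0// ltW.
apply: lime_le.
  by apply: is_cvg_nneseries => n _ _; rewrite lee_fin exprn_ge0// ltW.
apply: nearW => n; rewrite sumEFin lee_fin big_mkord.
have := geometric_le_lim n (@ler01 R) z0.
rewrite ger0_norm ?(ltW z0)// => /(_ z1); rewrite mul1r; apply: le_trans.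
rewrite /series/= big_mkord ler_sum// => i _.
by rewrite /geometric/= mul1r.
Qed.

(** Uniformity in [l] is the point: shifting the index by the floor of [l] changes distances by at
    most 1, which costs a factor e^d and leaves two geometric series. *)
Lemma esum_expR_dist (d : R) : (0 < d)%R -> exists2 C : R, (0 < C)%R &
  forall l : R, \esum_(k in [set: int]) (expR (- d * `|k%:~R - l|))%:E <= C%:E.
Proof.
move=> d0; pose z := expR (- d).
have z01 : (0 < z < 1)%R by rewrite expR_gt0 expR_lt1 oppr_lt0.
have g0 n : 0 <= (z ^+ n)%:E by rewrite lee_fin exprn_ge0// expR_ge0.
exists (expR d * (2 * (1 - z)^-1))%R => [|l].
  by rewrite mulr_gt0 ?expR_gt0// mulr_gt0// invr_gt0 subr_gt0; case/andP: z01.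
pose m := Num.floor l.
have bij_m : set_bij [set: int] [set: int] (+%R m).
  by [].
rewrite (reindex_esum _ _ _ _ bij_m).
have abs_le (k : int) :
    (expR (- d * `|(m + k)%:~R - l|))%:E <= (expR d)%:E * (z ^+ `|k|%N)%:E.
  rewrite -EFinM lee_fin -expRM_natl -expRD ler_expR.
  have /andP[lm ml] := floor_itv l.
  have -> : (`|k|%N%:R = `|k%:~R| :> R)%R by rewrite -intr_norm.
  have hk : (`|k%:~R : R| <= `|(m + k)%:~R - l| + 1)%R.
    have -> : (k%:~R = ((m + k)%:~R - l) + (l - m%:~R) :> R)%R.
      by rewrite intrD; ring.
    apply: le_trans (ler_normD _ _) _; rewrite lerD2l ger0_norm ?subr_ge0//.
    by move: ml; rewrite intrD -/m; lra.
  by nra.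
apply: le_trans (le_esum (fun k _ => abs_le k)) _.
apply: le_trans (esumZl _ _) _; rewrite ?lee_fin ?expR_ge0//.
rewrite EFinM; apply: lee_wpmul2l; first by rewrite lee_fin expR_ge0.
rewrite (esumID [set` (fun k : int => 0 <= k)%R])//.
rewrite (_ : 2 * _ = (1 - z)^-1 + (1 - z)^-1)%R; last by rewrite mulr_natl.
rewrite EFinD; apply: leeD.
  rewrite (_ : _ `&` _ = Posz @` [set: nat]); last first.
    rewrite setTI; apply/seteqP; split=> [[n|n]//= _|_ [n _ <-]//=].
    by exists n.
  rewrite esum_image; last by move=> i j _ _ [].
  exact: geometric_esum_le.
rewrite (_ : _ `&` _ = Negz @` [set: nat]); last first.
  rewrite setTI; apply/seteqP; split=> [[n|n]//= _|_ [n _ <-]//=].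
  by exists n.
rewrite esum_image; last by move=> i j _ _ [].
(* [Negz n] is -(n + 1), so its term is z^(n+1), at most z^n. *)
apply: le_trans (geometric_esum_le z01); apply: le_esum => n _.
by case/andP: z01 => z0 z1; rewrite lee_fin ler_wiXn2l// ltW.
Qed.

(** The p-th power of the kernel of rate d is the kernel of rate d p. *)
Lemma esum_expR_dist_powR (d p : R) : (0 < d)%R -> (0 < p)%R ->
  exists2 C : R, (0 < C)%R & forall l : R,
  \esum_(k in [set: int]) (expR (- d * `|k%:~R - l|))%:E `^ p <= C%:E.
Proof.
move=> d0 p0; have [C C0 hC] := esum_expR_dist (mulr_gt0 d0 p0).
exists C => // l; apply: le_trans (hC l); apply: le_esum => k _.
by rewrite poweR_EFin -expRM lee_fin ler_expR; lra.
Qed.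

Lemma lq_geometric q (d : R) : 0 < q -> (0 < d)%R ->
  exists2 C : R, (0 < C)%R & forall (l : R) x B, 0 <= B ->
  (forall k, 0 <= x k) ->
  (forall k, x k <= (expR (- d * `|k%:~R - l|))%:E * B) -> lq q x <= C%:E * B.
Proof.
case: q => [p p0 d0|_ d0|//].
  have [C C0 hC] := esum_expR_dist_powR d0 p0.
  exists (C `^ p^-1)%R => [|l x B B0 x0 hx]; first by rewrite powR_gt0.
  rewrite lte_fin in p0.
  rewrite lq_le_fin//; last by rewrite mule_ge0 ?lee_fin ?powR_ge0.
  rewrite poweRM ?lee_fin ?powR_ge0// -poweR_EFin poweRVK ?lee_fin ?(ltW C0)//.
  apply: (@le_trans _ _ (B `^ p *
    \esum_(k in [set: int]) (expR (- d * `|k%:~R - l|))%:E `^ p)).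
    apply: le_trans (esumZl _ _); rewrite ?poweR_ge0//; last first.
      by move=> k; exact: poweR_ge0.
    apply: le_esum => k _; rewrite muleC -poweRM ?lee_fin ?expR_ge0//.
    exact: le_poweR.
  by rewrite muleC; apply: lee_wpmul2r => //; exact: poweR_ge0.
exists 1%R => // l x B B0 x0 hx; rewrite mul1e; apply/lq_le_pinfty => k.
apply: le_trans (hx k) _; rewrite -[leRHS]mul1e; apply: lee_wpmul2r => //.
by rewrite lee_fin expR_le1 mulNr oppr_le0 mulr_ge0// ltW.
Qed.

(* Schur's test for a kernel that decays geometrically away from the graph
   of [l]; the supremum over [j] is expressed through its upper bounds. *)
Lemma lq_schur q (d : R) : 0 < q -> (0 < d)%R ->
  exists2 C : R, (0 < C)%R & forall (l : int -> R) x y,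
  (forall k, 0 <= x k) -> (forall k, 0 <= y k) ->
  (forall k B, 0 <= B ->
    (forall j, (expR (- d * `|k%:~R - l j|))%:E * y j <= B) -> x k <= B) ->
  lq q x <= C%:E * lq q y.
Proof.
case: q => [p p0 d0|_ d0|//].
  have [C C0 hC] := esum_expR_dist_powR d0 p0.
  exists (C `^ p^-1)%R => [|l x y x0 y0 hx]; first by rewrite powR_gt0.
  rewrite lte_fin in p0.
  pose w k j := (expR (- d * `|k%:~R - l j|))%:E * y j.
  have w0 k j : 0 <= w k j by rewrite mule_ge0// lee_fin expR_ge0.
  (* The hypothesis is applied with B the l_p norm of [w k], which dominates each of its terms; the
     supremum over j thus becomes a sum, for every p > 0. *)
  have xw k : x k `^ p <= \esum_(j in [set: int]) w k j `^ p.
    rewrite -[leRHS](poweRVK p0)//; apply: le_poweR => //.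
    apply: hx => [|j]; first exact: poweR_ge0.
    exact: (@lq_pt p%:E (w k) j).
  rewrite lq_le_fin//; last by rewrite mule_ge0 ?lee_fin ?powR_ge0 ?lq_ge0.
  rewrite poweRM ?lee_fin ?powR_ge0 ?lq_ge0//.
  rewrite -poweR_EFin poweRVK ?lee_fin ?(ltW C0)//.
  rewrite /lq poweRVK//.
  apply: le_trans (le_esum (fun k _ => xw k)) _.
  (* For fixed j, the sum of the kernel over k is bounded independently of the real number [l j]. *)
  rewrite esum_interchange; last by move=> *; exact: poweR_ge0.
  apply: le_trans (esumZl _ _); rewrite ?lee_fin ?(ltW C0)//; last first.
    by move=> k; exact: poweR_ge0.
  apply: le_esum => j _; rewrite muleC.
  apply: (@le_trans _ _ (y j `^ p *
    \esum_(k in [set: int]) (expR (- d * `|k%:~R - l j|))%:E `^ p)).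
    apply: le_trans (esumZl _ _); rewrite ?poweR_ge0//; last first.
      by move=> k; exact: poweR_ge0.
    by apply: le_esum => k _; rewrite muleC -poweRM ?lee_fin ?expR_ge0// muleC.
  by apply: lee_wpmul2l => //; exact: poweR_ge0.
exists 1%R => // l x y x0 y0 hx; rewrite mul1e; apply/lq_le_pinfty => k.
apply: (hx k) => [|j]; first exact: lq_ge0.
apply: le_trans (lq_pinfty_ub _ j); rewrite -[leRHS]mul1e.
apply: lee_wpmul2r => //.
by rewrite lee_fin expR_le1 mulNr oppr_le0 mulr_ge0// ltW.
Qed.

End SequenceNorm.

(** * Lebesgue norms with respect to dt/t *)

(** The integral of a nonnegative function is a supremum over the simple functions below it, so
    monotonicity holds for arbitrary functions. *)
Lemma ge0_le_integral_inner {d} {T : measurableType d} {R : realType}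
    (mu : {measure set T -> \bar R}) (f g : T -> \bar R) :
  (forall x, 0 <= f x)%E -> (forall x, f x <= g x)%E ->
  (\int[mu]_x f x <= \int[mu]_x g x)%E.
Proof.
move=> f0 fg; have g0 x : (0 <= g x)%E by exact: le_trans (fg x).
rewrite !ge0_integralTE//; apply: le_ereal_sup => _ [h hf <-]; exists h => // x.
exact: le_trans (hf x) (fg x).
Qed.

(** * The partition of (0, oo) into the blocks [e^k, e^(k+1)[ *)

Section ExponentialBlocks.
Context {R : realType}.
Local Notation mu := (@completed_lebesgue_measure R).

Definition lfloor (t : R) : int := Num.floor (ln t).

Definition block (k : int) : set R := `[expR k%:~R, expR (k + 1)%:~R[%classic.

Lemma blockP (k : int) (t : R) : block k t <-> 0 < t /\ lfloor t = k.
Proof.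
rewrite /block/= in_itv/=; split=> [/andP[h1 h2]|[t0 <-]].
  have t0 : 0 < t := lt_le_trans (expR_gt0 _) h1.
  split=> //; apply: floor_def.
  by rewrite -ler_expR -ltr_expR lnK ?posrE// h1 h2.
by have := floor_itv (ln t); rewrite -ler_expR -ltr_expR lnK ?posrE.
Qed.

Lemma lfloor_le (t : R) : 0 < t -> expR (lfloor t)%:~R <= t.
Proof.
move=> t0; have : block (lfloor t) t by apply/blockP.
by rewrite /block/= in_itv => /andP[].
Qed.

Lemma lfloor_gt (t : R) : 0 < t -> t < expR (lfloor t + 1)%:~R.
Proof.
move=> t0; have : block (lfloor t) t by apply/blockP.
by rewrite /block/= in_itv => /andP[].
Qed.

Lemma block_length (k : int) :
  mu (block k) = (expR (k + 1)%:~R - expR k%:~R)%:E.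
Proof.
rewrite [LHS](lebesgue_measure_itv `[expR k%:~R, expR (k + 1)%:~R[)/=.
by rewrite lte_fin ltr_expR ltr_int ltrDl EFinB.
Qed.

Lemma measurable_block (k : int) :
  measurable (block k : set (caratheodory_type ((wlength idfun)^*)%mu)).
Proof. by apply: sub_caratheodory; exact: measurable_itv. Qed.

Lemma integral_block_fun (y : int -> \bar R) : (forall k, 0 <= y k)%E ->
  (\int[mu]_t ((fun t => y (lfloor t)) \_ `]0%R, +oo[) t =
   \esum_(k in [set: int]) (y k * (expR (k + 1)%:~R - expR k%:~R)%:E))%E.
Proof.
move=> y0; rewrite -integral_mkcond.
(* The enumeration 0, -1, 1, -2, 2, ... of the integers turns the partition into a countable union
   indexed by [nat]. *)
pose e n : int := if odd n then Negz n./2 else Posz n./2.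
have e_bij : set_bij [set: nat] [set: int] e.
  split=> //.
    move=> i j _ _ eij; suff [oij hij] : odd i = odd j /\ i./2 = j./2.
      by rewrite -(odd_double_half i) oij hij odd_double_half.
    by move: eij; rewrite /e; case: (odd i); case: (odd j) => // -[].
  move=> [m|m] _.
    by exists m.*2 => //; rewrite /e odd_double doubleK.
  by exists m.*2.+1 => //; rewrite /e /= odd_double/= uphalf_double.
have -> : `]0, +oo[%classic = \bigcup_n block (e n).
  apply/seteqP; split=> t /=; rewrite ?in_itv/= ?andbT; last first.
    by move=> [n _ /blockP[]].
  move=> t0; have [_ _ /(_ (lfloor t) I)[n _ en]] := e_bij.
  by exists n => //; apply/blockP; rewrite en.
have mb n := measurable_block (e n).
rewrite (ge0_integral_bigcup _ mb)//; last 2 first.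
- apply/measurable_fun_bigcup => // n.
  move=> _ Y _; have [yY|yY] := pselect (Y (y (e n))).
    rewrite (_ : _ `&` _ = block (e n)); first exact: mb.
    by apply/seteqP; split=> [t []//|t tb]; split=> //=; have /blockP[_ ->] := tb.
  rewrite (_ : _ `&` _ = set0)//.
  by apply/seteqP; split=> // t [/blockP[_ /= ->]].
- move=> i j _ _ [t [/blockP[_ ti] /blockP[_ tj]]].
  by have [_ inj _] := e_bij; apply: inj; rewrite ?inE// -ti -tj.
rewrite nneseries_esumT => [|n]; last by apply: integral_ge0.
rewrite (reindex_esum _ _ _ _ e_bij); apply: eq_esum => n _.
transitivity (\int[mu]_(t in block (e n)) cst (y (e n)) t)%E.
  by apply: eq_integral => t /set_mem/blockP[_ ->].
rewrite integral_cst; last exact: mb.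
by congr (_ * _)%E; exact: block_length.
Qed.

(** On the block k the density 1/t lies between e^(-k-1) and e^(-k). Multiplied by the length of the
    block, these bounds no longer depend on k: c = e - 1 for d = 0, and c = 1 - e^(-1) for d =
    -1. *)
Lemma esum_block_length (y : int -> \bar R) (c d : R) :
  (forall k, 0 <= y k)%E -> 0 <= c ->
  (forall k : int, expR (- k%:~R + d) * (expR (k + 1)%:~R - expR k%:~R) = c) ->
  (\esum_(k in [set: int])
    ((expR (- k%:~R + d))%:E * y k * (expR (k + 1)%:~R - expR k%:~R)%:E) =
   \esum_(k in [set: int]) (c%:E * y k))%E.
Proof.
by move=> y0 c0 h; apply: eq_esum => k _; rewrite muleAC -EFinM h.
Qed.

End ExponentialBlocks.

(** * The norm of L_q(dt/t) and its comparison with sequences indexed by blocks *)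

Section MultiplicativeNorm.
Context {R : realType}.
Local Open Scope ereal_scope.
Local Notation mu := (@completed_lebesgue_measure R).
Implicit Types (q : \bar R) (f g : R -> \bar R).

(* The norm of L_q for the measure dt/t on (0, +oo). *)
Definition mnorm q f : \bar R :=
  Lqnorm q `]0%R, +oo[ (fun t => (t `^ (- rcp q))%:E * f t).

Lemma Lqnorm_mnorm q (D : set R) F f : D `<=` `]0%R, +oo[ ->
  (forall t, D t -> F t = (t `^ (- rcp q))%:E * f t) ->
  Lqnorm q D F = mnorm q (f \_ D).
Proof.
move=> D0 Ff; rewrite /mnorm /Lqnorm; congr Lnorm; apply/funext => t.
rewrite !patchE; have [/set_mem Dt|_] := boolP (t \in D); last first.
  by rewrite mule0 if_same.
by rewrite mem_set ?Ff//; exact: D0.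
Qed.

Lemma mnorm_ge0 q f : 0 <= mnorm q f.
Proof. exact: Lnorm_ge0. Qed.

Lemma rcpE (p : R) : rcp p%:E = (p^-1)%R.
Proof. by rewrite /rcp inver; case: eqP => [->|]//=; rewrite ?invr0. Qed.

Lemma rcp_pinfty : rcp (+oo : \bar R) = 0%R.
Proof. by rewrite /rcp invey. Qed.

Lemma mnorm_fin (p : R) f : (0 < p)%R ->
  (forall t, (0 < t)%R -> 0 <= f t) ->
  mnorm p%:E f =
  (\int[mu]_t ((fun t => (t^-1)%:E * f t `^ p) \_ `]0%R, +oo[) t) `^ p^-1.
Proof.
move=> p0 f0; rewrite /mnorm /Lqnorm unlock /=; congr (_ `^ _).
apply: eq_integral => t _; rewrite !patchE.
case: ifPn => [/set_mem/=|_]; last by rewrite abse0 poweR0r// gt_eqF.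
rewrite in_itv/= andbT => t0.
rewrite gee0_abs; last by rewrite mule_ge0 ?lee_fin ?powR_ge0 ?f0.
rewrite poweRM ?lee_fin ?powR_ge0 ?f0// rcpE poweR_EFin.
by rewrite -powRrM mulNr mulVf ?gt_eqF// powR_inv1// ltW.
Qed.

Lemma integral_dlog_ge0 (f : R -> \bar R) (p : R) :
  0 <= \int[mu]_t ((fun t => (t^-1)%:E * f t `^ p) \_ `]0%R, +oo[) t.
Proof.
apply: integral_ge0 => t _; apply: erestrict_ge0 => u.
by rewrite /= in_itv/= andbT => u0; rewrite mule_ge0 ?poweR_ge0// lee_fin invr_ge0 ltW.
Qed.

Lemma mnorm_pinfty_le f (B : \bar R) : 0 <= B ->
  (forall t, (0 < t)%R -> 0 <= f t <= B) -> mnorm +oo f <= B.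
Proof.
move=> B0 fB; rewrite /mnorm /Lqnorm unlock; case: ifPn => // _.
apply/ess_supP; apply: nearW => t /=; rewrite patchE.
case: ifPn => [/set_mem/=|_]; last by rewrite abse0.
rewrite in_itv/= andbT => /fB/andP[f0 fB'].
by rewrite rcp_pinfty oppr0 powRr0 mul1e gee0_abs.
Qed.

Lemma block_length_gt0 (k : int) : 0 < mu (block k).
Proof. by rewrite block_length lte_fin subr_gt0 ltr_expR ltr_int ltrDl. Qed.

(** A block has positive measure, so it cannot lie in the null set outside which the essential
    supremum is an upper bound. *)
Lemma mnorm_pinfty_ge f (k : int) (x : \bar R) :
  (forall t, (0 < t)%R -> 0 <= f t) -> (forall t, block k t -> x <= f t) ->
  x <= mnorm +oo f.
Proof.
move=> f0 xf; rewrite /mnorm /Lqnorm unlock.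
set F := (X in abse \o X); have muT : 0 < mu setT.
  apply: lt_le_trans (block_length_gt0 0%R) _; apply: le_measure => //; rewrite inE//.
  exact: measurable_block.
rewrite ifT//; rewrite leNgt; apply/negP => lt_x.
have [N [mN N0 hN]] := ess_sup_ge mu (abse \o F).
have : mu (block k) <= mu N.
  apply: le_measure; rewrite ?inE//; first exact: measurable_block.
  move=> t kt; apply: hN => /= hle; move: lt_x; rewrite ltNge => /negP; apply.
  apply: le_trans (xf _ kt) _; apply: le_trans hle.
  have /blockP[t0 _] := kt.
  rewrite /F patchE mem_set/=; last by rewrite in_itv/= t0.
  by rewrite rcp_pinfty oppr0 powRr0 mul1e gee0_abs ?f0.
by rewrite N0 leNgt block_length_gt0.
Qed.

(** For finite q the integrand is dominated pointwise by a function constant on blocks, whose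
    integral is computed exactly; hence [f] can be arbitrary. *)
Lemma mnorm_le_lq q : 0 < q -> exists2 C : R, (0 < C)%R &
  forall f (x : int -> \bar R), (forall t, (0 < t)%R -> 0 <= f t) ->
  (forall t, (0 < t)%R -> f t <= x (lfloor t)) -> (forall k, 0 <= x k) ->
  mnorm q f <= C%:E * lq q x.
Proof.
case: q => [p p0|_|//]; last first.
  exists 1%R => // f x f0 fx x0; rewrite mul1e; apply: mnorm_pinfty_le.
    exact: lq_ge0.
  by move=> t t0; rewrite f0// (le_trans (fx t t0))//; exact: lq_pinfty_ub.
rewrite lte_fin in p0; pose c : R := (expR 1 - 1)%R.
have c0 : (0 < c)%R by rewrite subr_gt0 expR_gt1.
exists (c `^ p^-1)%R => [|f x f0 fx x0]; first exact: powR_gt0.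
rewrite mnorm_fin// poweRV_le//; last 2 first.
- exact: integral_dlog_ge0.
- by rewrite mule_ge0 ?lee_fin ?powR_ge0 ?lq_ge0.
rewrite poweRM ?lee_fin ?powR_ge0 ?lq_ge0// -poweR_EFin poweRVK ?lee_fin ?(ltW c0)//.
rewrite /lq poweRVK ?esum_ge0//; last by move=> k _; exact: poweR_ge0.
pose y k := (expR (- k%:~R + 0))%:E * x k `^ p.
have y0 k : 0 <= y k by rewrite mule_ge0 ?poweR_ge0// lee_fin expR_ge0.
apply: (@le_trans _ _ (\int[mu]_t ((fun t => y (lfloor t)) \_ `]0%R, +oo[) t)).
  apply: ge0_le_integral_inner => t.
    apply: erestrict_ge0 => u; rewrite /= in_itv/= andbT => u0.
    by rewrite mule_ge0 ?poweR_ge0// lee_fin invr_ge0 ltW.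
  apply: lee_restrict => u; rewrite /= in_itv/= andbT => u0.
  apply: lee_pmul; rewrite ?poweR_ge0 ?lee_fin ?invr_ge0 ?(ltW u0)//.
    by rewrite addr0 expRN lef_pV2 ?posrE ?expR_gt0// lfloor_le.
  by apply: le_poweR; rewrite ?f0 ?fx.
rewrite integral_block_fun// (esum_block_length (c := c))//.
- by apply: esumZl => [|k]; rewrite ?lee_fin ?(ltW c0) ?poweR_ge0.
- by move=> k; exact: poweR_ge0.
- exact: ltW.
- by move=> k; rewrite addr0 mulrBr -!expRD intrD addKr addNr expR0.
Qed.

Lemma lq_le_mnorm q : 0 < q -> exists2 C : R, (0 < C)%R &
  forall f (x : int -> \bar R), (forall t, (0 < t)%R -> 0 <= f t) ->
  (forall t, (0 < t)%R -> x (lfloor t) <= f t) -> (forall k, 0 <= x k) ->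
  lq q x <= C%:E * mnorm q f.
Proof.
case: q => [p p0|_|//]; last first.
  exists 1%R => // f x f0 fx x0; rewrite mul1e; apply/lq_le_pinfty => k.
  apply: (@mnorm_pinfty_ge f k) => // t /blockP[t0 <-]; exact: fx.
rewrite lte_fin in p0; pose c : R := (1 - expR (-1))%R.
have c0 : (0 < c)%R by rewrite subr_gt0 expR_lt1 oppr_lt0.
exists ((c^-1) `^ p^-1)%R => [|f x f0 fx x0]; first by rewrite powR_gt0 ?invr_gt0.
rewrite mnorm_fin// lq_le_fin//; last first.
  by rewrite mule_ge0 ?lee_fin ?powR_ge0 ?poweR_ge0.
rewrite poweRM ?lee_fin ?powR_ge0 ?poweR_ge0// -poweR_EFin.
have ci0 : (0 <= c^-1)%R by rewrite invr_ge0 ltW.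
rewrite poweRVK ?lee_fin// poweRVK//; last first.
  exact: integral_dlog_ge0.
pose y k := (expR (- k%:~R + -1))%:E * x k `^ p.
have y0 k : 0 <= y k by rewrite mule_ge0 ?poweR_ge0// lee_fin expR_ge0.
have hy : \int[mu]_t ((fun t => y (lfloor t)) \_ `]0%R, +oo[) t <=
    \int[mu]_t ((fun t => (t^-1)%:E * f t `^ p) \_ `]0%R, +oo[) t.
  apply: ge0_le_integral_inner => t; first by apply: erestrict_ge0 => u _.
  apply: lee_restrict => u; rewrite /= in_itv/= andbT => u0.
  apply: lee_pmul; rewrite ?poweR_ge0 ?lee_fin ?expR_ge0//.
    rewrite -opprD expRN lef_pV2 ?posrE ?expR_gt0// ltW//.
    by have := lfloor_gt u0; rewrite intrD.
  by apply: le_poweR; rewrite ?fx.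
apply: le_trans (lee_wpmul2l _ hy); rewrite ?lee_fin//.
rewrite integral_block_fun// (esum_block_length (c := c))//; last 3 first.
- by move=> k; exact: poweR_ge0.
- exact: ltW.
- move=> k; rewrite mulrBr -!expRD intrD.
  by rewrite addrACA addNr addNr addr0 expR0 addrAC addNr add0r.
rewrite [leLHS](_ : _ = \esum_(k in [set: int]) ((c^-1)%:E * (c%:E * x k `^ p))).
  by apply: esumZl => [|k]; rewrite ?lee_fin// mule_ge0 ?poweR_ge0 ?lee_fin ?ltW.
by apply: eq_esum => k _; rewrite muleA -EFinM mulVf ?gt_eqF// mul1e.
Qed.

End MultiplicativeNorm.

(** * The l_q norm of block suprema *)

Section AmalgamNorm.
Context {R : realType}.
Local Open Scope ereal_scope.
Implicit Types (q B : \bar R) (f g h : R -> \bar R).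

Definition nonneg_fun f := forall t : R, (0 < t)%R -> 0 <= f t.

Definition sup_block f (k : int) : \bar R := ereal_sup (f @` block k).

(* An upper substitute for [mnorm] which is subadditive without any
   measurability assumption. *)
Definition amnorm q f : \bar R := lq q (sup_block f).

Lemma sup_block_ub f t : (0 < t)%R -> f t <= sup_block f (lfloor t).
Proof. by move=> t0; apply: ereal_sup_ubound; exists t => //; apply/blockP. Qed.

Lemma sup_block_le f k B :
  (forall t, (0 < t)%R -> lfloor t = k -> f t <= B) -> sup_block f k <= B.
Proof. by move=> h; apply: ge_ereal_sup => _ [t /blockP[t0 tk] <-]; exact: h. Qed.

Lemma sup_block_ge0 f k : nonneg_fun f -> 0 <= sup_block f k.
Proof.
move=> f0; apply: le_trans (f0 _ (expR_gt0 k%:~R)) _.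
apply: ereal_sup_ubound; exists (expR k%:~R) => //.
apply/blockP; split; first exact: expR_gt0.
by rewrite /lfloor expRK intrKfloor.
Qed.

Lemma amnorm_ge0 q f : nonneg_fun f -> 0 <= amnorm q f.
Proof. by move=> f0; apply: lq_ge0 => k; exact: sup_block_ge0. Qed.

Lemma lfloor_dist (t : R) : (0 < t)%R -> (`|ln t - (lfloor t)%:~R| <= 1)%R.
Proof.
move=> t0; have := floor_itv (ln t); rewrite -/(lfloor t) intrD => /andP[? ?].
by rewrite ler_norml; lra.
Qed.

Lemma lfloor_expR_dist (d t l : R) : (0 < d)%R -> (0 < t)%R ->
  (expR (- d * `|ln t - l|) <=
   expR (- d * `|(lfloor t)%:~R - l|) * expR d)%R.
Proof.
move=> d0 t0; rewrite -expRD ler_expR.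
have : (`|(lfloor t)%:~R - l| <= `|ln t - l| + 1)%R.
  apply: le_trans (ler_distD (ln t) _ _) _.
  by rewrite addrC lerD2l distrC; exact: lfloor_dist.
by nra.
Qed.

Lemma same_block_dist (s t : R) : (0 < s)%R -> (0 < t)%R ->
  lfloor s = lfloor t -> (`|ln s - ln t| <= 1)%R.
Proof.
move=> s0 t0 st; have := floor_itv (ln s); have := floor_itv (ln t).
rewrite -!/(lfloor _) st intrD => /andP[? ?] /andP[? ?].
by rewrite ler_norml; lra.
Qed.

Lemma mnorm_le_amnorm q : 0 < q -> exists2 C : R, (0 < C)%R &
  forall f, nonneg_fun f -> mnorm q f <= C%:E * amnorm q f.
Proof.
move=> q0; have [C C0 hC] := mnorm_le_lq q0; exists C => // f f0.
by apply: hC => // [t t0|k]; [exact: sup_block_ub|exact: sup_block_ge0].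
Qed.

Lemma amnorm_le_scale q f g (c : R) : 0 < q -> (0 <= c)%R -> nonneg_fun f ->
  nonneg_fun g -> (forall t, (0 < t)%R -> f t <= c%:E * g t) ->
  amnorm q f <= c%:E * amnorm q g.
Proof.
move=> q0 c0 f0 g0 fg.
apply: le_trans (lq_scale q0 _ _) => [||k]; rewrite ?lee_fin ?sup_block_ge0//.
apply: lq_mono => // k; first exact: sup_block_ge0.
apply: sup_block_le => t t0 <-; apply: le_trans (fg _ t0) _.
by apply: lee_wpmul2l; rewrite ?lee_fin ?sup_block_ub.
Qed.

Lemma amnorm_pt q f t : 0 < q -> nonneg_fun f -> (0 < t)%R -> f t <= amnorm q f.
Proof.
move=> q0 f0 t0; apply: le_trans (sup_block_ub f t0) _.
by apply: lq_pt => // k; exact: sup_block_ge0.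
Qed.

(** Points of one block are within logarithmic distance 1, so a bound at that distance carries a
    supremum over a block to every value of [g] on it. Two functions are allowed because the cut-off
    of a tail does not satisfy such a bound with itself. *)
Lemma amnorm_le_mnorm q : 0 < q -> exists2 C : R, (0 < C)%R &
  forall f g (c : R), (0 < c)%R -> nonneg_fun f -> nonneg_fun g ->
  (forall s t, (0 < s)%R -> (0 < t)%R -> (`|ln s - ln t| <= 1)%R ->
    f s <= c%:E * g t) ->
  amnorm q f <= (C * c)%:E * mnorm q g.
Proof.
move=> q0; have [C C0 hC] := lq_le_mnorm q0; exists C => // f g c c0 f0 g0 fg.
have ci0 : (0 <= c^-1)%R by rewrite invr_ge0 ltW.
have scaled k : sup_block f k = c%:E * ((c^-1)%:E * sup_block f k).
  by rewrite muleA -EFinM mulfV ?gt_eqF// mul1e.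
rewrite /amnorm (_ : sup_block f = fun k => c%:E * ((c^-1)%:E * sup_block f k)).
  have h0 k : 0 <= (c^-1)%:E * sup_block f k.
    by rewrite mule_ge0 ?lee_fin ?sup_block_ge0.
  apply: le_trans (lq_scale q0 _ h0) _; first by rewrite lee_fin ltW.
  rewrite mulrC EFinM -muleA; apply: lee_wpmul2l; first by rewrite lee_fin ltW.
  apply: hC => // t t0.
  have cc : (c^-1 * c = 1)%R by rewrite mulVf ?gt_eqF.
  rewrite -[leRHS]mul1e -cc EFinM -muleA.
  apply: lee_wpmul2l; first by rewrite lee_fin.
  apply: sup_block_le => s s0 st; apply: fg => //; exact: same_block_dist.
by apply/funext => k; exact: scaled.
Qed.

(** On each block the larger of the two suprema dominates, even if the alternative changes from
    point to point. *)
Lemma amnorm_max q : 0 < q -> exists2 C : R, (0 < C)%R &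
  forall f g h B, 0 <= B -> nonneg_fun f -> nonneg_fun g -> nonneg_fun h ->
  (forall t, (0 < t)%R -> f t <= g t \/ f t <= h t) ->
  amnorm q g <= B -> amnorm q h <= B -> amnorm q f <= C%:E * B.
Proof.
move=> q0; have [C C0 hC] := lq_max q0; exists C => // f g h B B0 f0 g0 h0 fgh.
apply: hC => // k; rewrite ?sup_block_ge0//.
have [hg|/ltW gh] := leP (sup_block h k) (sup_block g k); [left|right].
  apply: sup_block_le => t t0 tk; subst k.
  by case: (fgh t t0) => /le_trans; apply; [|apply: le_trans hg];
    exact: sup_block_ub.
apply: sup_block_le => t t0 tk; subst k.
by case: (fgh t t0) => /le_trans; apply; [apply: le_trans gh|];
  exact: sup_block_ub.
Qed.

Lemma amnorm_geometric q (d : R) : 0 < q -> (0 < d)%R ->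
  exists2 C : R, (0 < C)%R & forall (l : R) f B, 0 <= B -> nonneg_fun f ->
  (forall t, (0 < t)%R -> f t <= (expR (- d * `|ln t - l|))%:E * B) ->
  amnorm q f <= C%:E * B.
Proof.
move=> q0 d0; have [C C0 hC] := lq_geometric q0 d0.
exists (C * expR d)%R => [|l f B B0 f0 hf]; first by rewrite mulr_gt0// expR_gt0.
rewrite EFinM -muleA; apply: (hC l) => [|k|k].
- by rewrite mule_ge0// lee_fin expR_ge0.
- exact: sup_block_ge0.
apply: sup_block_le => t t0 <-; apply: le_trans (hf _ t0) _.
rewrite muleA -EFinM; apply: lee_wpmul2r => //.
by rewrite lee_fin; exact: lfloor_expR_dist.
Qed.

(** Replacing ln t by the index of its block costs the factor e^d; in the other variable the kernel
    already depends on the block only. *)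
Lemma amnorm_schur q (d : R) : 0 < q -> (0 < d)%R ->
  exists2 C : R, (0 < C)%R & forall (l : int -> R) f g (c : R), (0 < c)%R ->
  nonneg_fun f -> nonneg_fun g ->
  (forall t B, (0 < t)%R -> 0 <= B ->
    (forall s, (0 < s)%R ->
      (expR (- d * `|ln t - l (lfloor s)|))%:E * g s <= B) ->
    f t <= c%:E * B) ->
  amnorm q f <= (C * c)%:E * amnorm q g.
Proof.
move=> q0 d0; have [C C0 hC] := lq_schur q0 d0.
exists (C * expR d)%R => [|l f g c c0 f0 g0 hfg]; first by rewrite mulr_gt0// expR_gt0.
have cd0 : (0 < expR d * c)%R by rewrite mulr_gt0// expR_gt0.
have y0 k : 0 <= (expR d * c)%:E * sup_block g k.
  by rewrite mule_ge0 ?lee_fin ?(ltW cd0) ?sup_block_ge0.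
rewrite -mulrA EFinM -muleA.
apply: (@le_trans _ _ (C%:E * lq q (fun k => (expR d * c)%:E * sup_block g k))).
  apply: (hC l) => // [k|k B B0 hB]; first exact: sup_block_ge0.
  apply: sup_block_le => t t0 tk.
  have ci : (c * c^-1 = 1)%R by rewrite mulfV ?gt_eqF.
  rewrite -[leRHS]mul1e -ci EFinM -muleA; apply: hfg => //.
    by rewrite mule_ge0// lee_fin invr_ge0 ltW.
  move=> s s0; apply: le_trans (lee_wpmul2l _ (hB (lfloor s))); last first.
    by rewrite lee_fin invr_ge0 ltW.
  rewrite !muleA -!EFinM; apply: lee_pmul; rewrite ?lee_fin ?expR_ge0 ?g0//.
    rewrite [leRHS](_ : _ = expR (- d * `|k%:~R - l (lfloor s)|) * expR d)%R.
      by rewrite -tk; exact: lfloor_expR_dist.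
    by field; rewrite gt_eqF.
  exact: sup_block_ub.
apply: lee_wpmul2l; first by rewrite lee_fin ltW.
by apply: lq_scale => // [|k]; [rewrite lee_fin ltW|exact: sup_block_ge0].
Qed.

End AmalgamNorm.

(** * Slow functions and their tails *)

Section SlowFunctions.
Context {R : realType}.
Implicit Types (b g h : R -> R).

(* Slow variation read in logarithmic coordinates, which turns products and
   powers into sums and multiples; no measurability is required. *)
Definition slow b :=
  positive_fun b /\ forall e : R, 0 < e -> exists2 C : R, 0 <= C &
    forall s t : R, 0 < s -> 0 < t ->
      `|ln (b s) - ln (b t)| <= C + e * `|ln s - ln t|.

(** A one-sided bound suffices, as s and t can be exchanged. *)
Lemma slow_intro b : positive_fun b ->
  (forall e : R, 0 < e -> exists2 C : R, 0 < C &
    forall s t : R, 0 < s -> 0 < t ->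
      b s <= C * expR (e * `|ln s - ln t|) * b t) -> slow b.
Proof.
move=> b0 h; split=> // e e0; have [C C0 hC] := h e e0.
have lnb s t : 0 < s -> 0 < t ->
    ln (b s) - ln (b t) <= `|ln C| + e * `|ln s - ln t|.
  move=> s0 t0; have := hC s t s0 t0; rewrite -ler_ln ?posrE ?b0//; last first.
    by rewrite !mulr_gt0 ?expR_gt0 ?b0.
  rewrite !lnM ?posrE ?mulr_gt0 ?expR_gt0 ?b0// expRK.
  by have := ler_norm (ln C); lra.
exists `|ln C| => // s t s0 t0.
have := lnb s t s0 t0; have := lnb t s t0 s0.
by rewrite (distrC (ln t)) ler_norml => *; lra.
Qed.

Lemma slow_le b : slow b -> forall e : R, 0 < e -> exists2 C : R, 0 < C &
    forall s t : R, 0 < s -> 0 < t ->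
      b s <= C * expR (e * `|ln s - ln t|) * b t.
Proof.
move=> [b0 h] e e0; have [C C0 hC] := h e e0.
exists (expR C) => [|s t s0 t0]; first exact: expR_gt0.
rewrite -expRD -[leLHS]lnK ?posrE ?b0// -[X in _ <= _ * X]lnK ?posrE ?b0//.
rewrite -expRD ler_expR; have := hC s t s0 t0.
by rewrite ler_norml; lra.
Qed.

Lemma slowM b g : slow b -> slow g -> slow (fun t => b t * g t).
Proof.
move=> [b0 hb] [g0 hg]; split=> [t t0|e e0]; first by rewrite mulr_gt0 ?b0 ?g0.
have e20 : 0 < e / 2 by lra.
have [C C0 hC] := hb _ e20; have [D D0 hD] := hg _ e20.
exists (C + D) => [|s t s0 t0]; first by rewrite addr_ge0.
rewrite !lnM ?posrE ?b0 ?g0//.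
have := hC s t s0 t0; have := hD s t s0 t0.
by rewrite !ler_norml => /andP[? ?] /andP[? ?]; lra.
Qed.

Lemma slow_powR b (p : R) : slow b -> slow (fun t => b t `^ p).
Proof.
move=> [b0 hb]; split=> [t t0|e e0]; first by rewrite powR_gt0// b0.
(* The summand 1 keeps the divisor positive when p = 0. *)
have p0 : 0 < `|p| + 1 by rewrite ltr_wpDl.
have ep0 : 0 < e / (`|p| + 1) by rewrite divr_gt0.
have [C C0 hC] := hb _ ep0.
exists ((`|p| + 1) * C) => [|s t s0 t0]; first by rewrite mulr_ge0// ltW.
rewrite !ln_powR -mulrBr normrM.
apply: le_trans (_ : (`|p| + 1) * `|ln (b s) - ln (b t)| <= _).
  by rewrite ler_wpM2r// lerDl.
apply: le_trans (ler_wpM2l (ltW p0) (hC s t s0 t0)) _.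
by rewrite mulrDr mulrA mulrCA mulfV ?gt_eqF// mulr1.
Qed.

Lemma slowV b : slow b -> slow (fun t => (b t)^-1).
Proof.
move=> [b0 hb]; split=> [t t0|e e0]; first by rewrite invr_gt0 b0.
have [C C0 hC] := hb _ e0; exists C => // s t s0 t0.
by rewrite !lnV ?posrE ?b0// opprK addrC distrC; exact: hC.
Qed.

Lemma slow_div b g : slow b -> slow g -> slow (fun t => b t / g t).
Proof. by move=> sb sg; apply: slowM => //; exact: slowV. Qed.

(** As a function of ln t, ln rho is Lipschitz with constant L up to the error M, so the rate e / (L
    + 1) for [a] gives the rate e for the composition. *)
Lemma slow_comp a (rho : R -> R) (L M : R) : slow a -> positive_fun rho ->
  0 <= L -> 0 <= M -> (forall s t, 0 < s -> 0 < t ->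
    `|ln (rho s) - ln (rho t)| <= M + L * `|ln s - ln t|) ->
  slow (fun t => a (rho t)).
Proof.
move=> [a0 ha] rho0 L0 M0 hrho; split=> [t t0|e e0]; first exact/a0/rho0.
have L1 : 0 < L + 1 by lra.
have [C C0 hC] := ha _ (divr_gt0 e0 L1).
exists (C + e / (L + 1) * M) => [|s t s0 t0].
  by rewrite addr_ge0// mulr_ge0// divr_ge0// ltW.
apply: le_trans (hC _ _ (rho0 s s0) (rho0 t t0)) _.
rewrite -addrA lerD2l.
apply: le_trans (ler_wpM2l _ (hrho s t s0 t0)) _; first by rewrite divr_ge0// ltW.
rewrite mulrDr lerD2l mulrA ler_wpM2r// mulrAC ler_pdivrMr//.
by nra.
Qed.

(** For s <= t the increasing equivalent of t^e b gives b(s) <= C1^2 (t/s)^e b(t); for t <= s the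
    decreasing equivalent of t^(-e) b gives b(s) <= C2^2 (s/t)^e b(t). *)
Lemma slowly_varying_slow b : slowly_varying b -> slow b.
Proof.
move=> [b0 _ hb]; apply: slow_intro => // e e0.
have [[g [g0 gi [C1 h1]]] [h [h0 hd [C2 h2]]]] := hb e e0.
have pow_pos (t p : R) : 0 < t -> 0 < t `^ p by exact: powR_gt0.
have bt0 (t p : R) : 0 < t -> 0 < t `^ p * b t.
  by move=> t0; rewrite mulr_gt0 ?powR_gt0 ?b0.
(* An equivalence does not state that its constant is positive; this is read off at the point 1. *)
have C10 : 0 < C1.
  have [_ hC] := h1 1 ltr01; rewrite -(pmulr_lgt0 _ (bt0 1 e ltr01)).
  exact: lt_le_trans (g0 1 ltr01) hC.
have C20 : 0 < C2.
  have [_ hC] := h2 1 ltr01; rewrite -(pmulr_lgt0 _ (bt0 1 (- e) ltr01)).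
  exact: lt_le_trans (h0 1 ltr01) hC.
exists (C1 * C1 + C2 * C2) => [|s t s0 t0]; first by rewrite addr_gt0 ?mulr_gt0.
have sE (x : R) : 0 < x -> x \in `]0, +oo[ by move=> x0; rewrite in_itv/= x0.
have powE (x p : R) : 0 < x -> x `^ p = expR (p * ln x).
  by move=> x0; rewrite /powR gt_eqF.
have key (p C : R) : 0 < C -> C * C <= C1 * C1 + C2 * C2 ->
    p * (ln t - ln s) = e * `|ln s - ln t| ->
    s `^ p * b s <= C * (C * (t `^ p * b t)) ->
    b s <= (C1 * C1 + C2 * C2) * expR (e * `|ln s - ln t|) * b t.
  move=> C0 CC pE hs; rewrite -pE -(ler_pM2l (pow_pos s p s0)).
  apply: le_trans hs _.
  rewrite !powE//.
  have -> : expR (p * ln t) = expR (p * ln s) * expR (p * (ln t - ln s)).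
    by rewrite -expRD; congr expR; ring.
  set E := expR (p * ln s); set F := expR (p * (ln t - ln s)).
  rewrite [leLHS](_ : _ = C * C * (E * F * b t)); last by ring.
  rewrite [leRHS](_ : _ = (C1 * C1 + C2 * C2) * (E * F * b t)); last by ring.
  by rewrite ler_wpM2r// !mulr_ge0 ?expR_ge0// ltW// b0.
have [st|/ltW ts] := leP s t.
  have lst : ln s <= ln t by rewrite ler_ln ?posrE.
  apply: (key e C1) => //.
  - by rewrite lerDl mulr_ge0// ltW.
  - by rewrite distrC ger0_norm// subr_ge0.
  apply: le_trans (h1 s s0).1 _; rewrite ler_pM2l//.
  by apply: le_trans (h1 t t0).2; apply: gi => //; exact: sE.
have lst : ln t <= ln s by rewrite ler_ln ?posrE.
apply: (key (- e) C2) => //.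
- by rewrite lerDr mulr_ge0// ltW.
- by rewrite ger0_norm ?subr_ge0//; ring.
apply: le_trans (h2 s s0).1 _; rewrite ler_pM2l//.
by apply: le_trans (h2 t t0).2; apply: hd => //; exact: sE.
Qed.

End SlowFunctions.

(** * Norms of slow functions over (t, oo) and (0, t) *)

Section Tails.
Context {R : realType}.
Implicit Types (b : R -> R) (q : \bar R) (P : set R).

(** A condition on ln s - ln t treats both kinds of tails at once and is carried along by
    dilations. *)
Definition tail_set P (t : R) : set R := [set s | 0 < s /\ P (ln s - ln t)].

Definition positives : set R := [set x | 0 < x].
Definition negatives : set R := [set x | x < 0].

Lemma tail_set_gt (t : R) : 0 < t ->
  `]t, +oo[%classic = tail_set positives t.
Proof.
move=> t0; apply/seteqP; split=> s;
  rewrite /tail_set /positives /negatives /= in_itv/= andbT.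
  move=> ts; have s0 := lt_trans t0 ts; split=> //=.
  by rewrite subr_gt0 ltr_ln.
by move=> [s0] /=; rewrite subr_gt0 ltr_ln.
Qed.

Lemma tail_set_lt (t : R) : 0 < t ->
  `]0, t[%classic = tail_set negatives t.
Proof.
move=> t0; apply/seteqP; split=> s;
  rewrite /tail_set /positives /negatives /= in_itv/=.
  by move=> /andP[s0 st]; split=> //=; rewrite subr_lt0 ltr_ln.
by move=> [s0] /=; rewrite subr_lt0 ltr_ln ?posrE// => ->; rewrite s0.
Qed.

Local Notation tail b P t := ((EFin \o b) \_ (tail_set P t)).

Lemma tail_ge0 b P t : positive_fun b -> nonneg_fun (tail b P t).
Proof.
by move=> b0 s s0; rewrite patchE; case: ifP => // _; rewrite lee_fin ltW// b0.
Qed.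

Lemma tail_in b P (s t : R) : 0 < s -> P (ln s - ln t) ->
  (tail b P t) s = (b s)%:E.
Proof. by move=> s0 Ps; rewrite patchE mem_set. Qed.

(** The dilation by t/s maps the tail at s onto the tail at t and changes [b] by at most a factor D
    e^(e |ln s - ln t|). It does not respect blocks, so it is carried out by Schur's test with [l]
    the opposite translation. *)
Lemma amnorm_tail_le q b P (e : R) : (0 < q)%E -> slow b -> 0 < e ->
  exists2 C : R, 0 < C & forall s t : R, 0 < s -> 0 < t ->
  (amnorm q (tail b P s) <=
   (C * expR (e * `|ln s - ln t|))%:E * amnorm q (tail b P t))%E.
Proof.
move=> q0 sb e0; have [b0 _] := sb.
have [C C0 hC] := amnorm_schur q0 (@ltr01 R).
have [D D0 hD] := slow_le sb e0.
exists (C * (D * expR 1)) => [|s t s0 t0]; first by rewrite !mulr_gt0// expR_gt0.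
rewrite -mulrA; apply: (hC (fun j : int => j%:~R + (ln s - ln t))).
- by rewrite !mulr_gt0 ?expR_gt0.
- exact: tail_ge0.
- exact: tail_ge0.
move=> x B x0 B0 hB; rewrite patchE; case: ifPn => [/set_mem[_ Px]|_]; last first.
  by rewrite mule_ge0// lee_fin !mulr_ge0 ?expR_ge0// ltW.
pose y := x * t / s; have y0 : 0 < y by rewrite divr_gt0 ?mulr_gt0.
have lny : ln y = ln x - (ln s - ln t).
  by rewrite /y ln_div ?lnM ?posrE ?mulr_gt0//; ring.
have := hB y y0; rewrite tail_in//; last by rewrite lny; congr P: Px; ring.
rewrite /= => hBy.
have {hBy}bB : ((b y)%:E <= (expR 1)%:E * B)%E.
  apply: le_trans (lee_wpmul2l _ hBy); last by rewrite lee_fin expR_ge0.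
  rewrite -!EFinM lee_fin mulrA -expRD ler_peMl ?(ltW (b0 y y0))//.
  rewrite -[leLHS]expR0 ler_expR.
  have := lfloor_dist y0; 
  rewrite (_ : ln y - _ = ln x - ((lfloor y)%:~R + (ln s - ln t))).
    by lra.
  by rewrite lny; ring.
apply: (@le_trans _ _ ((D * expR (e * `|ln s - ln t|))%:E * (b y)%:E)%E).
  rewrite -EFinM lee_fin; have := hD x y x0 y0.
  by rewrite (_ : ln x - ln y = ln s - ln t)//; rewrite lny; ring.
apply: le_trans (lee_wpmul2l _ bB) _.
  by rewrite lee_fin mulr_ge0 ?expR_ge0// ltW.
by rewrite muleA -EFinM mulrAC.
Qed.

(* Shifting the end point of a tail by [tau] makes room for all points within
   logarithmic distance 1. *)
Definition shiftable P (tau : R) :=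
  P tau /\ forall x y : R, P x -> `|x - y| <= 1 -> P (y + tau).

Lemma shiftable_positives : shiftable positives 1.
Proof. by split=> [|x y]; rewrite /positives/= // => x0; rewrite ler_norml; lra. Qed.

Lemma shiftable_negatives : shiftable negatives (- 1).
Proof.
split=> [|x y]; rewrite /negatives/= ?oppr_lt0// => x0.
by rewrite ler_norml; lra.
Qed.

(** Moving the end point to t e^tau costs a constant by [amnorm_tail_le]; all points within
    logarithmic distance 1 of the new tail lie in the tail at t. *)
Lemma amnorm_tail_le_mnorm q b P tau : (0 < q)%E -> slow b -> shiftable P tau ->
  exists2 C : R, 0 < C & forall t : R, 0 < t ->
  (amnorm q (tail b P t) <= C%:E * mnorm q (tail b P t))%E.
Proof.
move=> q0 sb [_ hP]; have [b0 _] := sb.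
have [C C0 hC] := amnorm_le_mnorm q0.
have [D D0 hD] := slow_le sb (@ltr01 R).
have [F F0 hF] := amnorm_tail_le P q0 sb (@ltr01 R).
exists (F * expR `|tau| * (C * (D * expR 1))) => [|t t0].
  by rewrite !mulr_gt0 ?expR_gt0.
pose t' := t * expR tau; have t'0 : 0 < t' by rewrite mulr_gt0 ?expR_gt0.
have lnt' : ln t' = ln t + tau by rewrite lnM ?posrE ?expR_gt0// expRK.
apply: le_trans (hF t t' t0 t'0) _.
rewrite lnt' (_ : ln t - _ = - tau); last by ring.
rewrite normrN mul1r [in leRHS]EFinM -[leRHS]muleA; apply: lee_wpmul2l.
  by rewrite lee_fin mulr_ge0 ?expR_ge0// ltW.
apply: hC => [|||x y x0 y0 xy].
- by rewrite mulr_gt0 ?expR_gt0.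
- exact: tail_ge0.
- exact: tail_ge0.
rewrite [leLHS]patchE; case: ifPn => [/set_mem[_ Px]|_]; last first.
  by rewrite mule_ge0 ?lee_fin ?mulr_ge0 ?expR_ge0 ?(ltW D0)//; exact: tail_ge0.
rewrite tail_in//; last first.
  rewrite (_ : ln y - ln t = ln y - ln t' + tau); last by rewrite lnt'; ring.
  by apply: hP Px _; rewrite (_ : _ - _ = ln x - ln y)//; ring.
rewrite -EFinM lee_fin /=; apply: le_trans (hD x y x0 y0) _.
by rewrite ler_wpM2r ?(ltW (b0 y y0))// ler_wpM2l ?(ltW D0)// ler_expR mul1r.
Qed.

(** Everything is read off [amnorm], where moving the end point from t to s costs only C e^(e |ln s
    - ln t|): finiteness spreads from the point 1 to all t, and [c] inherits slowness. *)
Lemma tail_slow q b P tau (c : R -> R) : (0 < q)%E -> slow b ->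
  shiftable P tau -> (mnorm q (tail b P 1%R) < +oo)%E ->
  (forall t, 0 < t -> c t = fine (mnorm q (tail b P t))) ->
  [/\ slow c, forall t, 0 < t -> mnorm q (tail b P t) = (c t)%:E,
    (exists2 C : R, 0 < C & forall t, 0 < t -> b t <= C * c t) &
    exists2 C : R, 0 < C & forall t, 0 < t ->
      (amnorm q (tail b P t) <= (C * c t)%:E)%E].
Proof.
move=> q0 sb sP fin1 cE; have [b0 _] := sb.
have [C C0 hC] := amnorm_tail_le_mnorm q0 sb sP.
have [M M0 hM] := mnorm_le_amnorm q0.
have fin_am1 : (amnorm q (tail b P 1%R) < +oo)%E.
  apply: le_lt_trans (hC 1 ltr01) _.
  by rewrite lte_mul_pinfty ?lee_fin ?(ltW C0)// ge0_fin_numE.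
have fin t : 0 < t -> mnorm q (tail b P t) \is a fin_num.
  move=> t0; rewrite ge0_fin_numE ?mnorm_ge0//.
  apply: le_lt_trans (hM _ (tail_ge0 _ _ b0)) _.
  rewrite lte_mul_pinfty ?lee_fin ?(ltW M0)//.
  have [F F0 hF] := amnorm_tail_le P q0 sb (@ltr01 R).
  apply: le_lt_trans (hF t 1 t0 ltr01) _.
  by rewrite lte_mul_pinfty ?lee_fin ?mulr_ge0 ?expR_ge0 ?(ltW F0).
have mE t : 0 < t -> mnorm q (tail b P t) = (c t)%:E.
  by move=> t0; rewrite cE// fineK ?fin.
have amc : exists2 C : R, 0 < C & forall t, 0 < t ->
      (amnorm q (tail b P t) <= (C * c t)%:E)%E.
  by exists C => // t t0; rewrite EFinM -mE//; exact: hC.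
have bc : exists2 C : R, 0 < C & forall t, 0 < t -> b t <= C * c t.
  have [F F0 hF] := amnorm_tail_le P q0 sb (@ltr01 R).
  exists (F * expR `|tau| * C) => [|t t0]; first by rewrite !mulr_gt0 ?expR_gt0.
  (* Since [P tau] holds, t belongs to the tail at t', so b(t) is one of the values that [amnorm]
     bounds. *)
  pose t' := t * expR (- tau); have t'0 : 0 < t' by rewrite mulr_gt0 ?expR_gt0.
  have lnt' : ln t' = ln t - tau by rewrite lnM ?posrE ?expR_gt0// expRK.
  rewrite -lee_fin.
  have := amnorm_pt q0 (tail_ge0 P t' b0) t0; rewrite tail_in//; last first.
    by rewrite lnt' (_ : _ - _ = tau); [case: sP|ring].
  move=> /le_trans; apply; apply: le_trans (hF t' t t'0 t0) _.
  rewrite lnt' (_ : _ - ln t = - tau); last by ring.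
  rewrite normrN mul1r -(mulrA _ C) [leRHS]EFinM; apply: lee_wpmul2l.
    by rewrite lee_fin mulr_ge0 ?expR_ge0// ltW.
  by rewrite EFinM -mE//; exact: hC.
split=> //; apply: slow_intro => [t t0|e e0].
  have [D D0 hD] := bc; have := lt_le_trans (b0 t t0) (hD t t0).
  by rewrite pmulr_rgt0.
have [F F0 hF] := amnorm_tail_le P q0 sb e0.
exists (M * (F * C)) => [|s t s0 t0]; first by rewrite !mulr_gt0.
rewrite -lee_fin -mE//; apply: le_trans (hM _ (tail_ge0 _ _ b0)) _.
rewrite -!mulrA EFinM; apply: lee_wpmul2l; first by rewrite lee_fin ltW.
apply: le_trans (hF s t s0 t0) _.
rewrite [in leRHS](_ : _ * _ = F * expR (e * `|ln s - ln t|) * (C * c t)); last by ring.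
rewrite [leRHS]EFinM; apply: lee_wpmul2l.
  by rewrite lee_fin mulr_ge0 ?expR_ge0// ltW.
by rewrite EFinM -mE//; exact: hC.
Qed.

End Tails.

(** * The K-functional *)

Section KFunctional.
Context {R : realType} {V : topologicalLmodType R}.
Implicit Types (X : qnspace R V) (f : V).

(** The factor 2 is slack for an infimum that need not be attained. *)
Definition near_optimal X0 X1 (t : R) f f0 f1 :=
  [/\ carrier X0 f0, carrier X1 f1, f = f0 + f1,
    qnorm X0 f0 <= 2 * Kfun X0 X1 t f & t * qnorm X1 f1 <= 2 * Kfun X0 X1 t f].

Definition nonneg_qnorm X := forall x, carrier X x -> 0 <= qnorm X x.

Section TwoSpaces.
Variables (X0 X1 : qnspace R V).
Hypotheses (nn0 : nonneg_qnorm X0) (nn1 : nonneg_qnorm X1).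
Local Notation K := (Kfun X0 X1).

Let Kset (t : R) f : set R :=
  [set s | exists f0 f1, [/\ carrier X0 f0, carrier X1 f1, f = f0 + f1 &
                             s = qnorm X0 f0 + t * qnorm X1 f1]].

Lemma Kfun_le (t : R) f0 f1 : 0 <= t -> carrier X0 f0 -> carrier X1 f1 ->
  K t (f0 + f1) <= qnorm X0 f0 + t * qnorm X1 f1.
Proof.
move=> t0 c0 c1; apply: ge_inf; last by exists f0, f1.
exists 0 => _ [g0 [g1 [d0 d1 _ ->]]].
by rewrite addr_ge0 ?mulr_ge0 ?nn0 ?nn1.
Qed.

Lemma le_Kfun (t B : R) f : sum_carrier X0 X1 f ->
  (forall f0 f1, carrier X0 f0 -> carrier X1 f1 -> f = f0 + f1 ->
    B <= qnorm X0 f0 + t * qnorm X1 f1) -> B <= K t f.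
Proof.
move=> [f0 [f1 [c0 c1 fE]]] h; apply: lb_le_inf.
  by exists (qnorm X0 f0 + t * qnorm X1 f1), f0, f1.
by move=> _ [g0 [g1 [d0 d1 gE ->]]]; exact: h.
Qed.

Lemma Kfun_ge0 (t : R) f : 0 <= t -> sum_carrier X0 X1 f -> 0 <= K t f.
Proof.
move=> t0 sf; apply: le_Kfun => // f0 f1 c0 c1 _.
by rewrite addr_ge0 ?mulr_ge0 ?nn0 ?nn1.
Qed.

Lemma Kfun_homo (s t : R) f : sum_carrier X0 X1 f -> 0 <= s -> s <= t ->
  K s f <= K t f.
Proof.
move=> sf s0 st; apply: le_Kfun => // f0 f1 c0 c1 ->.
apply: le_trans (Kfun_le s0 c0 c1) _.
by rewrite lerD2l ler_wpM2r// nn1.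
Qed.

Lemma Kfun_ratio (s t : R) f : sum_carrier X0 X1 f -> 0 < s -> s <= t ->
  K t f <= t / s * K s f.
Proof.
move=> sf s0 st; have t0 : 0 < t by exact: lt_le_trans st.
rewrite -ler_pdivrMl ?divr_gt0//; apply: le_Kfun => // f0 f1 c0 c1 ->.
rewrite ler_pdivrMl ?divr_gt0//; apply: le_trans (Kfun_le (ltW t0) c0 c1) _.
rewrite mulrDr mulrA divfK ?gt_eqF// lerD2r ler_peMl ?nn0//.
by rewrite ler_pdivlMr// mul1r.
Qed.

(** K(t, f) is nondecreasing and K(t, f)/t is nonincreasing in t. *)
Lemma Kfun_dist (s t : R) f : sum_carrier X0 X1 f -> 0 < s -> 0 < t ->
  K s f <= expR `|ln s - ln t| * K t f.
Proof.
move=> sf s0 t0; have [st|/ltW ts] := leP s t.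
  apply: le_trans (Kfun_homo sf (ltW s0) st) _.
  by rewrite ler_peMl ?Kfun_ge0 ?(ltW t0)// -[leLHS]expR0 ler_expR.
apply: le_trans (Kfun_ratio sf t0 ts) _.
rewrite ler_wpM2r ?Kfun_ge0 ?(ltW t0)//.
by rewrite -[leLHS]lnK ?posrE ?divr_gt0// ler_expR ln_div ?posrE// ler_norm.
Qed.

Lemma Kfun_decomposition (t : R) f : sum_carrier X0 X1 f -> 0 < K t f -> 0 <= t ->
  exists f0 f1, near_optimal X0 X1 t f f0 f1.
Proof.
move=> sf K0 t0.
have [|_ [f0 [f1 [c0 c1 fE ->]]] hlt] := @inf_adherent _ (Kset t f) _ K0.
  split; last first.
    exists 0 => _ [g0 [g1 [d0 d1 _ ->]]].
    by rewrite addr_ge0 ?mulr_ge0 ?nn0 ?nn1.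
  case: sf => f0 [f1 [c0 c1 fE]].
  by exists (qnorm X0 f0 + t * qnorm X1 f1), f0, f1.
have n0 : 0 <= qnorm X0 f0 by exact: nn0.
have n1 : 0 <= t * qnorm X1 f1 by rewrite mulr_ge0// nn1.
have : qnorm X0 f0 + t * qnorm X1 f1 < K t f + K t f by exact: hlt.
by exists f0, f1; split=> //; lra.
Qed.

End TwoSpaces.

Section CompatibleCouple.
Variables (A0 A1 : qnspace R V).
Hypothesis hA : compatible_couple A0 A1.
Local Notation K := (Kfun A0 A1).

Let nn0 : nonneg_qnorm A0. Proof. by case: hA => _ [_ [h _ _ _] _]. Qed.
Let nn1 : nonneg_qnorm A1. Proof. by case: hA => _ _ [_ [h _ _ _] _]. Qed.

(** When K vanishes, f splits into parts of arbitrarily small norms. The continuous embeddings then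
    put f in every neighbourhood of 0, and the ambient space is Hausdorff. *)
Lemma Kfun_eq0 (t : R) f : 0 < t -> sum_carrier A0 A1 f -> K t f = 0 -> f = 0.
Proof.
move=> t0 sf Kf0; have [hV _ _ emb0 emb1] := hA.
apply/esym/hV => A B nA nB; exists f; split; last exact: nbhs_singleton.
have : nbhs ((0 : V) + 0) A by rewrite addr0.
move=> /(@add_continuous V (0, 0))[[U W]/= [nU nW] UW].
have [d0 d00 hd0] := emb0 _ nU; have [d1 d10 hd1] := emb1 _ nW.
have e0 : 0 < Num.min d0 (t * d1) by rewrite lt_min d00 mulr_gt0.
have : inf [set s | exists f0 f1, [/\ carrier A0 f0, carrier A1 f1, f = f0 + f1 &
    s = qnorm A0 f0 + t * qnorm A1 f1]] < Num.min d0 (t * d1) by rewrite [inf _]Kf0.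
move=> /inf_lt[|_ [f0 [f1 [c0 c1 -> ->]]]].
  by case: sf => f0 [f1 [c0 c1 fE]]; exists (qnorm A0 f0 + t * qnorm A1 f1), f0, f1.
have n0 := nn0 c0; have n1 : 0 <= t * qnorm A1 f1 by rewrite mulr_ge0 ?(ltW t0) ?nn1.
rewrite lt_min => /andP[h0 h1].
apply: (UW (f0, f1)); split=> /=; first by apply: hd0 => //; lra.
by apply: hd1 => //; rewrite -(ltr_pM2l t0); lra.
Qed.

Lemma qnorm0 X : Defs.subspace X -> quasi_norm X -> qnorm X 0 = 0.
Proof.
move=> [c0 _ _] [_ _ hZ _]; rewrite -(scale0r (0 : V)) hZ// normr0 mul0r //.
Qed.

(** If K > 0, the bound 2 K lies strictly above the infimum; if K = 0, then f = 0 and the splitting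
    0 + 0 serves. *)
Lemma couple_decomposition (t : R) f : 0 < t -> sum_carrier A0 A1 f ->
  exists f0 f1, near_optimal A0 A1 t f f0 f1.
Proof.
move=> t0 sf; have := Kfun_ge0 nn0 nn1 (ltW t0) sf.
rewrite le_eqVlt => /predU1P[/esym Kf0|K0]; last first.
  by apply: Kfun_decomposition => //; exact: ltW.
have [_ [s0 q0 _] [s1 q1 _] _ _] := hA.
have [[c0 _ _] [c1 _ _]] := (s0, s1).
exists 0, 0; split=> //; first by rewrite addr0; exact: Kfun_eq0 Kf0.
  by rewrite Kf0 mulr0 qnorm0.
by rewrite Kf0 mulr0 qnorm0// mulr0.
Qed.

Lemma Kfun_triangle : exists2 C : R, 0 < C & forall (u : R) f g, 0 <= u ->
  sum_carrier A0 A1 f -> sum_carrier A0 A1 g ->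
  K u (f + g) <= C * (K u f + K u g).
Proof.
have [_ [s0 q0 _] [s1 q1 _] _ _] := hA.
have [_ _ _ [C0 hC0]] := q0; have [_ _ _ [C1 hC1]] := q1.
(* A positive constant above both quasi-triangle constants, whatever their signs. *)
pose C := `|C0| + `|C1| + 1.
have C_gt0 : 0 < C by rewrite ltr_wpDl// addr_ge0.
have CC0 : C0 <= C by have := ler_norm C0; have := normr_ge0 C1; rewrite /C; lra.
have CC1 : C1 <= C by have := ler_norm C1; have := normr_ge0 C0; rewrite /C; lra.
exists C => // u f g u0 sf sg.
rewrite -ler_pdivrMl// -lerBlDr; apply: le_Kfun => // f0 f1 cf0 cf1 fE.
rewrite lerBlDr -lerBlDl; apply: le_Kfun => // g0 g1 cg0 cg1 gE.
rewrite lerBlDl ler_pdivrMl// fE gE addrACA.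
have [[_ D0 _] [_ D1 _]] := (s0, s1).
apply: le_trans (Kfun_le nn0 nn1 u0 (D0 _ _ cf0 cg0) (D1 _ _ cf1 cg1)) _.
have {}hC0 := hC0 _ _ cf0 cg0; have {}hC1 := hC1 _ _ cf1 cg1.
have n0 : 0 <= qnorm A0 f0 + qnorm A0 g0 by rewrite addr_ge0 ?nn0.
have n1 : 0 <= qnorm A1 f1 + qnorm A1 g1 by rewrite addr_ge0 ?nn1.
have h0 : qnorm A0 (f0 + g0) <= C * (qnorm A0 f0 + qnorm A0 g0).
  by apply: le_trans hC0 _; rewrite ler_wpM2r.
have h1 : u * qnorm A1 (f1 + g1) <= u * (C * (qnorm A1 f1 + qnorm A1 g1)).
  by rewrite ler_wpM2l//; apply: le_trans hC1 _; rewrite ler_wpM2r.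
by apply: le_trans (lerD h0 h1) _; rewrite le_eqVlt; apply/orP; left; apply/eqP; ring.
Qed.

Lemma sum_carrier0l f : carrier A0 f -> sum_carrier A0 A1 f.
Proof.
have [_ _ [[c1 _ _] _ _] _ _] := hA.
by move=> cf; exists f, 0; split=> //; rewrite addr0.
Qed.

Lemma sum_carrier0r f : carrier A1 f -> sum_carrier A0 A1 f.
Proof.
have [_ [[c0 _ _] _ _] _ _ _] := hA.
by move=> cf; exists 0, f; split=> //; rewrite add0r.
Qed.

Lemma sum_carrierD f g : sum_carrier A0 A1 f -> sum_carrier A0 A1 g ->
  sum_carrier A0 A1 (f + g).
Proof.
have [_ [[_ D0 _] _ _] [[_ D1 _] _ _] _ _] := hA.
move=> [f0 [f1 [c0 c1 ->]]] [g0 [g1 [d0 d1 ->]]].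
by exists (f0 + g0), (f1 + g1); rewrite addrACA; split=> //; [exact: D0|exact: D1].
Qed.

Lemma Kfun_left (u : R) f : 0 <= u -> carrier A0 f -> K u f <= qnorm A0 f.
Proof.
have [_ _ [s1 q1 _] _ _] := hA; have [c1 _ _] := s1.
move=> u0 cf; rewrite -[X in K _ X]addr0.
by apply: le_trans (Kfun_le nn0 nn1 u0 cf c1) _; rewrite qnorm0// mulr0 addr0.
Qed.

Lemma Kfun_right (u : R) f : 0 <= u -> carrier A1 f -> K u f <= u * qnorm A1 f.
Proof.
have [_ [s0 q0 _] _ _ _] := hA; have [c0 _ _] := s0.
move=> u0 cf; rewrite -[X in K _ X]add0r.
by apply: le_trans (Kfun_le nn0 nn1 u0 c0 cf) _; rewrite qnorm0// add0r.
Qed.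

(** Write f0 = f - f1 and f1 = f - f0. For an almost optimal splitting at t, the extra term is
    absorbed by K(u, f) when u <= t in the first bound and when u >= t in the second. *)
Lemma Kfun_parts : exists2 C : R, 0 < C & forall (u : R) f0 f1, 0 <= u ->
  carrier A0 f0 -> carrier A1 f1 ->
  K u f0 <= C * (K u (f0 + f1) + u * qnorm A1 f1) /\
  K u f1 <= C * (K u (f0 + f1) + qnorm A0 f0).
Proof.
have [C C0 hC] := Kfun_triangle; exists C => // u f0 f1 u0 c0 c1.
have [_ [[_ _ Z0] [_ _ nZ0 _] _] [[_ _ Z1] [_ _ nZ1 _] _] _ _] := hA.
have sf : sum_carrier A0 A1 (f0 + f1) by exists f0, f1.
have m0 : carrier A0 (- f0) by rewrite -scaleN1r; exact: Z0.
have m1 : carrier A1 (- f1) by rewrite -scaleN1r; exact: Z1.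
split.
  rewrite -[X in K u X <= _](addrK f1).
  apply: le_trans (hC u _ _ u0 sf (sum_carrier0r m1)) _.
  rewrite ler_pM2l// lerD2l; apply: le_trans (Kfun_right u0 m1) _.
  by rewrite -scaleN1r nZ1// normrN1 mul1r.
rewrite -[X in K u X <= _](addKr f0) addrC.
apply: le_trans (hC u _ _ u0 sf (sum_carrier0l m0)) _.
rewrite ler_pM2l// lerD2l; apply: le_trans (Kfun_left u0 m0) _.
by rewrite -scaleN1r nZ0// normrN1 mul1r.
Qed.

End CompatibleCouple.

End KFunctional.

(** * The interpolation norms expressed by [mnorm] *)

Section NormFormulas.
Context {R : realType} {V : topologicalLmodType R}.
Implicit Types (X : qnspace R V) (q : \bar R) (f : V).

Lemma eq_mnorm q (f g : R -> \bar R) :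
  (forall t, 0 < t -> f t = g t) -> mnorm q f = mnorm q g.
Proof.
move=> fg; rewrite /mnorm /Lqnorm; congr Lnorm; apply/funext => t.
rewrite !patchE; case: ifPn => // /set_mem/=; rewrite in_itv/= andbT => t0.
by rewrite fg.
Qed.

Lemma mnorm_restrict q (f : R -> \bar R) :
  mnorm q (f \_ `]0%R, +oo[) = mnorm q f.
Proof.
by apply: eq_mnorm => t t0; rewrite patchE mem_set//= in_itv/= t0.
Qed.

Lemma powR_split (t x y : R) : 0 < t -> t `^ (x - y) = t `^ (- y) * t `^ x.
Proof. by move=> t0; rewrite addrC powRD// (gt_eqF t0) /= implybT. Qed.

Lemma powR_expR (t x : R) : 0 < t -> t `^ x = expR (x * ln t).
Proof. by move=> t0; rewrite /powR gt_eqF. Qed.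

Lemma interp_normE X0 X1 (theta : R) q b f :
  interp_norm X0 X1 theta q b f =
  mnorm q (fun u => (u `^ (- theta) * b u * Kfun X0 X1 u f)%:E).
Proof.
rewrite /interp_norm -[RHS]mnorm_restrict; apply: Lqnorm_mnorm => // t.
by rewrite /= in_itv/= andbT => t0; rewrite powR_split// -EFinM !mulrA.
Qed.

Lemma interpR_normE X0 X1 (sigma : R) r b q a f :
  interpR_norm X0 X1 sigma r b q a f =
  mnorm r (fun t => ((b t / a t)%:E *
    mnorm q ((fun u => (u `^ (- sigma) * a u * Kfun X0 X1 u f)%:E)
      \_ (tail_set positives t)))%E).
Proof.
rewrite /interpR_norm -[RHS]mnorm_restrict; apply: Lqnorm_mnorm => // t.
rewrite /= in_itv/= andbT => t0; rewrite EFinM -muleA.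
congr (_ * (_ * _))%E; rewrite -tail_set_gt//; apply: Lqnorm_mnorm => s.
  by rewrite /= !in_itv/= !andbT; exact: lt_trans.
rewrite /= in_itv/= andbT => ts; have s0 := lt_trans t0 ts.
by rewrite powR_split// -EFinM !mulrA.
Qed.

Lemma nonneg_interp X0 X1 (theta : R) q b : nonneg_qnorm (interp X0 X1 theta q b).
Proof. by move=> f _; apply: fine_ge0; exact: Lnorm_ge0. Qed.

Lemma nonneg_interpR X0 X1 (sigma : R) r b q a :
  nonneg_qnorm (interpR X0 X1 sigma r b q a).
Proof. by move=> f _; apply: fine_ge0; exact: Lnorm_ge0. Qed.

Lemma interp_qnormE X0 X1 (theta : R) q b f :
  carrier (interp X0 X1 theta q b) f ->
  (qnorm (interp X0 X1 theta q b) f)%:E = interp_norm X0 X1 theta q b f.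
Proof.
by move=> [_ fin]; rewrite /= fineK// ge0_fin_numE//; exact: Lnorm_ge0.
Qed.

Lemma interpR_qnormE X0 X1 (sigma : R) r b q a f :
  carrier (interpR X0 X1 sigma r b q a) f ->
  (qnorm (interpR X0 X1 sigma r b q a) f)%:E = interpR_norm X0 X1 sigma r b q a f.
Proof.
by move=> [_ fin]; rewrite /= fineK// ge0_fin_numE//; exact: Lnorm_ge0.
Qed.

Lemma slow_powR_le (v : R -> R) (p e : R) : slow v -> 0 < e ->
  exists2 C : R, 0 < C & forall s t : R, 0 < s -> 0 < t ->
  s `^ p * v s <=
  C * expR (p * (ln s - ln t) + e * `|ln s - ln t|) * (t `^ p * v t).
Proof.
move=> sv e0; have [C C0 hC] := slow_le sv e0; exists C => // s t s0 t0.
rewrite expRD mulrBr expRB -!powR_expR//.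
rewrite [leRHS](_ : _ = s `^ p * (C * expR (e * `|ln s - ln t|) * v t)).
  by rewrite ler_pM2l ?powR_gt0//; exact: hC.
by field; rewrite gt_eqF// powR_gt0.
Qed.

End NormFormulas.

(** * Powers times slow functions: ln rho is a quasi-isometry in ln t *)

Section PowerLike.
Context {R : realType}.
Variables (rho kappa : R -> R) (alpha : R).
Hypotheses (alpha01 : 0 < alpha < 1) (slow_kappa : slow kappa).
Hypothesis rhoE : forall t, 0 < t -> rho t = t `^ alpha * kappa t.

Lemma ln_power_like t : 0 < t -> ln (rho t) = alpha * ln t + ln (kappa t).
Proof.
move=> t0; have [k0 _] := slow_kappa.
by rewrite rhoE// lnM ?posrE ?powR_gt0 ?k0// ln_powR.
Qed.

Lemma power_like_gt0 : positive_fun rho.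
Proof.
by move=> t t0; have [k0 _] := slow_kappa; rewrite rhoE// mulr_gt0 ?powR_gt0 ?k0.
Qed.

(** The rate alpha/2 is half the slope alpha, so the drift of ln kappa cannot cancel the growth of
    the power. *)
Lemma power_like_bounds : exists2 M : R, 0 <= M &
  forall s t : R, 0 < s -> 0 < t ->
    `|ln (rho s) - ln (rho t) - alpha * (ln s - ln t)| <=
    M + alpha / 2 * `|ln s - ln t|.
Proof.
have /andP[a0 a1] := alpha01.
have [_ /(_ (alpha / 2))[|M M0 hM]] := slow_kappa; first by rewrite divr_gt0.
exists M => // s t s0 t0; rewrite !ln_power_like//.
rewrite (_ : _ - _ = ln (kappa s) - ln (kappa t)); last by ring.
exact: hM.
Qed.

Lemma power_like_upper : exists2 M : R, 0 <= M &
  forall s t : R, 0 < s -> 0 < t ->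
    `|ln (rho s) - ln (rho t)| <= M + 2 * `|ln s - ln t|.
Proof.
have /andP[a0 a1] := alpha01.
have [M M0 hM] := power_like_bounds; exists M => // s t s0 t0.
have := hM s t s0 t0; set d := ln s - ln t; set D := _ - ln (rho t) => h.
rewrite (_ : D = (D - alpha * d) + alpha * d); last by ring.
apply: le_trans (ler_normD _ _) _; rewrite normrM (gtr0_norm a0).
by have := normr_ge0 d; nra.
Qed.

Lemma power_like_lower : exists2 M : R, 0 <= M &
  forall s t : R, 0 < s -> 0 < t ->
    alpha / 2 * `|ln s - ln t| <= M + `|ln (rho s) - ln (rho t)|.
Proof.
have /andP[a0 a1] := alpha01.
have [M M0 hM] := power_like_bounds; exists M => // s t s0 t0.
have := hM s t s0 t0; set d := ln s - ln t; set D := _ - ln (rho t) => h.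
have : `|alpha * d| <= `|D| + `|D - alpha * d|.
  by rewrite [X in `|X|](_ : _ = D - (D - alpha * d)); [exact: ler_normB|ring].
by rewrite normrM (gtr0_norm a0); lra.
Qed.

(** As rho may be discontinuous, a value is met only up to a constant factor. With S the set where
    phi <= v, take x1 in S within 1 of sup S and x2 = sup S + 1: then phi x1 <= v < phi x2, and the
    two values differ by at most N + 4. *)
Lemma power_like_dense : exists2 M : R, 0 <= M &
  forall u : R, 0 < u -> exists2 t : R, 0 < t & `|ln u - ln (rho t)| <= M.
Proof.
have /andP[a0 a1] := alpha01.
have [M M0 hM] := power_like_bounds; have [N N0 hN] := power_like_upper.
exists (N + 4) => [|u u0]; first by lra.
pose phi x := ln (rho (expR x)); set v := ln u.
have bnd x : `|phi x - phi 0 - alpha * x| <= M + alpha / 2 * `|x|.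
  by have := hM (expR x) (expR 0) (expR_gt0 _) (expR_gt0 _); rewrite !expRK subr0.
pose S := [set x | phi x <= v].
have S0 : S !=set0.
  (* For x <= 0, phi x <= phi 0 + M + (alpha/2) x, and this is at most v for the chosen x. *)
  pose x := Num.min 0 ((v - phi 0 - M) / (alpha / 2)); exists x => /=.
  have x0 : x <= 0 by rewrite /x ge_min lexx.
  have : x <= (v - phi 0 - M) / (alpha / 2) by rewrite /x ge_min lexx orbT.
  rewrite ler_pdivlMr ?divr_gt0// => hx.
  have := bnd x; rewrite (ler0_norm x0) ler_norml => /andP[_]. rewrite /S/=; lra.
have Sub : has_ubound S.
  exists (Num.max 0 ((v - phi 0 + M) / (alpha / 2))) => x; rewrite /S/= => Sx.
  rewrite le_max; have [//|/ltW x0] := leP x 0.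
  rewrite ler_pdivlMr ?divr_gt0//.
  by have := bnd x; rewrite (ger0_norm x0) ler_norml => /andP[+ _]; lra.
have [x1 Sx1 hx1] := sup_adherent (@ltr01 R) (conj S0 Sub).
have x1le : x1 <= sup S by exact: ub_le_sup.
pose x2 := sup S + 1.
have Sx2 : v < phi x2.
  rewrite ltNge; apply/negP => h; have : x2 <= sup S by exact: ub_le_sup.
  by rewrite /x2; lra.
exists (expR x1); first exact: expR_gt0.
have := hN (expR x2) (expR x1) (expR_gt0 _) (expR_gt0 _); rewrite !expRK.
rewrite -/(phi x1) -/(phi x2) (ger0_norm (_ : 0 <= x2 - x1)); last by rewrite /x2; lra.
rewrite -/v /S /= in Sx1 *; rewrite ler_norml => /andP[_ h].
by rewrite ger0_norm ?subr_ge0//; move: h; rewrite /x2; lra.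
Qed.

End PowerLike.

(** * Reiteration *)

(** The exponent |p| + 2 collects |p| from the power, 1 from the slow function and 1 from K. *)
Lemma slow_Kfun_le {R : realType} {V : topologicalLmodType R}
    (X0 X1 : qnspace R V) (p : R) (v : R -> R) :
  nonneg_qnorm X0 -> nonneg_qnorm X1 -> slow v ->
  exists2 C : R, 0 < C & forall f (s t : R), sum_carrier X0 X1 f ->
  0 < s -> 0 < t ->
  s `^ p * v s * Kfun X0 X1 s f <= C * expR ((`|p| + 2) * `|ln s - ln t|) *
    (t `^ p * v t * Kfun X0 X1 t f).
Proof.
move=> nn0 nn1 sv; have [v0 _] := sv.
have [D D0 hD] := slow_powR_le p sv (@ltr01 R).
exists D => // f s t sf s0 t0.
have h1 := Kfun_dist nn0 nn1 sf s0 t0.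
have ks := Kfun_ge0 nn0 nn1 (ltW s0) sf; have kt := Kfun_ge0 nn0 nn1 (ltW t0) sf.
apply: (@le_trans _ _ (D * expR (p * (ln s - ln t) + 1 * `|ln s - ln t|) *
    (t `^ p * v t) * (expR `|ln s - ln t| * Kfun X0 X1 t f))).
  by apply: ler_pM; rewrite ?mulr_ge0 ?powR_ge0 ?hD// ltW// v0.
set d := ln s - ln t.
rewrite [leLHS](_ : _ = D * (expR (p * d + 1 * `|d|) * expR `|d|) *
  (t `^ p * v t * Kfun X0 X1 t f)); last by ring.
rewrite ler_wpM2r ?mulr_ge0 ?powR_ge0// ?(ltW (v0 t t0))// ler_wpM2l ?(ltW D0)//.
rewrite -expRD ler_expR.
by have := ler_norm (p * d); rewrite normrM; lra.
Qed.

Section Reiteration.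
Context {R : realType} {V : topologicalLmodType R}.
Variables (A0 A1 : qnspace R V).
Hypothesis hA : compatible_couple A0 A1.
Variables (theta theta1 : R).
Hypotheses (htheta : 0 < theta < 1) (htheta1 : 0 < theta1 < 1).
Variables (q1 r0 r1 r : \bar R).
Hypotheses (hq1 : (0 < q1)%E) (hr0 : (0 < r0)%E) (hr1 : (0 < r1)%E)
  (hr : (0 < r)%E).
Variables (a a1 b0 b1 c0 d1 : R -> R).
Hypotheses (slow_a : slow a) (slow_a1 : slow a1) (slow_b0 : slow b0)
  (slow_b1 : slow b1) (slow_c0 : slow c0) (slow_d1 : slow d1).

Local Notation K := (Kfun A0 A1).
Local Notation tail b P t := ((EFin \o b) \_ (tail_set P t)).

Let h (t : R) := b1 t / a1 t.

(** These six hypotheses are conclusions of [tail_slow] for [b0] on (t, oo) and for [h] on (0, t);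
    the function c1 of the theorem is the product a1 d1. *)
Hypothesis mnorm_c0 : forall t, 0 < t ->
  mnorm r0 (tail b0 positives t) = (c0 t)%:E.
Hypothesis mnorm_d1 : forall t, 0 < t ->
  mnorm r1 (tail h negatives t) = (d1 t)%:E.
Hypothesis b0_le : exists2 C : R, 0 < C & forall t, 0 < t -> b0 t <= C * c0 t.
Hypothesis h_le : exists2 C : R, 0 < C & forall t, 0 < t -> h t <= C * d1 t.
Hypothesis amnorm_c0 : exists2 C : R, 0 < C & forall t, 0 < t ->
  (amnorm r0 (tail b0 positives t) <= (C * c0 t)%:E)%E.
Hypothesis amnorm_d1 : exists2 C : R, 0 < C & forall t, 0 < t ->
  (amnorm r1 (tail h negatives t) <= (C * d1 t)%:E)%E.

Let slow_h : slow h. Proof. exact: slow_div. Qed.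

Let a_gt0 : positive_fun a. Proof. by case: slow_a. Qed.
Let a1_gt0 : positive_fun a1. Proof. by case: slow_a1. Qed.
Let b0_gt0 : positive_fun b0. Proof. by case: slow_b0. Qed.
Let c0_gt0 : positive_fun c0. Proof. by case: slow_c0. Qed.
Let d1_gt0 : positive_fun d1. Proof. by case: slow_d1. Qed.
Let h_gt0 : positive_fun h. Proof. by case: slow_h. Qed.

Let c1 (t : R) := a1 t * d1 t.
Let kappa (t : R) := c0 t / c1 t.
Let rho (t : R) := t `^ theta1 * (c0 t / c1 t).

Let slow_kappa : slow kappa.
Proof. by apply: slow_div => //; exact: slowM. Qed.

Let nn0 : nonneg_qnorm A0. Proof. by case: hA => _ [_ [? _ _ _] _]. Qed.
Let nn1 : nonneg_qnorm A1. Proof. by case: hA => _ _ [_ [? _ _ _] _]. Qed.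

Let K_ge0 (t : R) f : 0 < t -> sum_carrier A0 A1 f -> 0 <= K t f.
Proof. by move=> t0; apply: Kfun_ge0 => //; exact: ltW. Qed.

(** * Lower bounds for the norms of [Y0] and [Y1] *)

Local Notation N0 := (interp_norm A0 A1 0 r0 b0).
Local Notation N1 := (interpR_norm A0 A1 theta1 r1 b1 q1 a1).
Local Notation Y0 := (interp A0 A1 0 r0 b0).
Local Notation Y1 := (interpR A0 A1 theta1 r1 b1 q1 a1).

Lemma interp0_normE f : N0 f = mnorm r0 (fun u => (b0 u * K u f)%:E).
Proof.
by rewrite interp_normE; apply: eq_mnorm => t _; rewrite oppr0 powRr0 mul1r.
Qed.

(** On (t, oo) one has K(t, f) <= K(u, f), so the norm of f dominates K(t, f) times the norm of [b0]
    over that tail. *)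
Lemma N0_lower : exists2 C : R, 0 < C & forall f t,
  sum_carrier A0 A1 f -> 0 < t -> ((c0 t * K t f)%:E <= C%:E * N0 f)%E.
Proof.
have [M M0 hM] := mnorm_le_amnorm hr0.
have [C C0 hC] := amnorm_le_mnorm hr0.
have [D D0 hD] := slow_le slow_b0 (@ltr01 R).
exists (M * (C * (D * expR 1 * expR 1))) => [|f t sf t0].
  by rewrite !mulr_gt0 ?expR_gt0.
(* The case K(t, f) = 0 is set apart because the comparison below divides by it. *)
have := K_ge0 t0 sf; rewrite le_eqVlt => /predU1P[<-|K0].
  by rewrite mulr0 mule_ge0 ?Lnorm_ge0// lee_fin !mulr_ge0 ?expR_ge0// ltW.
set E := D * expR 1 * expR 1; have E0 : 0 < E by rewrite !mulr_gt0 ?expR_gt0.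
have key : (amnorm r0 (tail b0 positives t) <= (C * (E / K t f))%:E * N0 f)%E.
  rewrite interp0_normE; apply: hC => [||u u0|x y x0 y0 xy].
  - by rewrite divr_gt0.
  - exact: tail_ge0.
  - by rewrite lee_fin mulr_ge0 ?K_ge0// ltW// b0_gt0.
  rewrite -EFinM patchE; case: ifPn => [/set_mem[_ Px]|_]; last first.
    by rewrite lee_fin !mulr_ge0 ?invr_ge0 ?K_ge0 ?expR_ge0// ?(ltW D0)// ltW// b0_gt0.
  have tx : t <= x by rewrite -ler_ln ?posrE// -subr_ge0 ltW.
  rewrite lee_fin /= -(ler_pM2r K0).
  have h1 := Kfun_homo nn0 nn1 sf (ltW t0) tx.
  have h2 := Kfun_dist nn0 nn1 sf x0 y0.
  have h3 := hD x y x0 y0; rewrite mul1r in h3.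
  have e1 : expR `|ln x - ln y| <= expR 1 by rewrite ler_expR.
  have k0 := K_ge0 y0 sf; have k1 := K_ge0 x0 sf; have by0 := b0_gt0 y0.
  have h3' : b0 x <= D * expR 1 * b0 y.
    by apply: le_trans h3 _; rewrite ler_wpM2r ?(ltW by0)// ler_wpM2l// ltW.
  have h2' : K t f <= expR 1 * K y f.
    by apply: le_trans h1 _; apply: le_trans h2 _; rewrite ler_wpM2r.
  rewrite [leRHS](_ : _ = (D * expR 1 * b0 y) * (expR 1 * K y f)).
    by apply: ler_pM => //; apply: ltW => //; exact: b0_gt0.
  by rewrite /E; field; rewrite gt_eqF.
rewrite EFinM -(mnorm_c0 t0) muleC.
have hm := hM _ (tail_ge0 positives t b0_gt0).
apply: (@le_trans _ _ ((K t f)%:E * (M%:E * ((C * (E / K t f))%:E * N0 f)))%E).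
  apply: lee_wpmul2l; first by rewrite lee_fin ltW.
  apply: le_trans hm _; apply: lee_wpmul2l => //.
  by rewrite lee_fin ltW.
rewrite !muleA -!EFinM; apply: lee_wpmul2r; first exact: Lnorm_ge0.
rewrite lee_fin le_eqVlt; apply/orP; left; apply/eqP; field.
by rewrite gt_eqF.
Qed.

(** [g f] is the inner integrand of the norm of [Y1] with respect to dt/t, and [Q f s] its norm over
    (s, oo). *)
Let g f (u : R) := u `^ (- theta1) * a1 u * K u f.
Let Q f (s : R) := mnorm q1 (tail (g f) positives s).

Let g_ge0 f (u : R) : 0 < u -> sum_carrier A0 A1 f -> 0 <= g f u.
Proof. by move=> u0 sf; rewrite !mulr_ge0 ?powR_ge0 ?K_ge0// ltW// a1_gt0. Qed.

Let tail_g_ge0 f P t : sum_carrier A0 A1 f -> nonneg_fun (tail (g f) P t).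
Proof.
move=> sf s s0; rewrite patchE; case: ifP => // _.
by rewrite lee_fin g_ge0.
Qed.

Lemma interpR1_normE f : N1 f = mnorm r1 (fun s => ((h s)%:E * Q f s)%E).
Proof. exact: interpR_normE. Qed.

(** The logarithmic neighbourhood of radius 1 of x = t e^3 lies beyond s, and there [g f] is
    comparable with its value at t. The margin ln s <= ln t + 1 is what the passage to blocks in
    [N1_lower] demands. *)
Lemma Q_lower : exists2 C : R, 0 < C & forall f s t, sum_carrier A0 A1 f ->
  0 < s -> 0 < t -> ln s <= ln t + 1 -> ((g f t)%:E <= C%:E * Q f s)%E.
Proof.
have [C C0 hC] := amnorm_le_mnorm hq1.
have [D D0 hD] := slow_Kfun_le (- theta1) nn0 nn1 slow_a1.
(* The points y compared with t satisfy |ln t - ln y| <= 4. *)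
pose L := expR ((`|- theta1| + 2) * 4).
exists (C * (D * L)) => [|f s t sf s0 t0 st].
  by rewrite !mulr_gt0// expR_gt0.
pose x := t * expR 3; have x0 : 0 < x by rewrite mulr_gt0// expR_gt0.
have lnx : ln x = ln t + 3 by rewrite lnM ?posrE ?expR_gt0// expRK.
(* Supported at one point: [amnorm] sees its value, although its Lebesgue norm vanishes. *)
pose f' (u : R) : \bar R := if u == x then (g f t)%:E else 0%E.
have f'0 : nonneg_fun f'.
  by move=> u u0; rewrite /f'; case: ifP => // _; rewrite lee_fin g_ge0.
have := amnorm_pt hq1 f'0 x0; rewrite {1}/f' eqxx => /le_trans; apply.
apply: hC => //; first by rewrite mulr_gt0// expR_gt0.
  exact: tail_g_ge0.
move=> u y u0 y0 uy.
rewrite {1}/f'; case: ifPn => [/eqP ux|_]; last first.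
  by rewrite mule_ge0 ?tail_g_ge0// lee_fin mulr_ge0 ?expR_ge0// ltW.
move: uy; rewrite ux lnx => uy.
rewrite tail_in//; last first.
  by rewrite /positives/=; move: uy; rewrite ler_norml; lra.
rewrite /= -EFinM lee_fin; apply: le_trans (hD f t y sf t0 y0) _.
rewrite ler_wpM2r ?g_ge0// ler_wpM2l ?(ltW D0)// ler_expR ler_wpM2l//.
by move: uy; rewrite !ler_norml; lra.
Qed.

(** For s < t the inner norm [Q f s] is at least a multiple of [g f t]; the norm of [h] over (0, t)
    is d1(t). *)
Lemma N1_lower : exists2 C : R, 0 < C & forall f t, sum_carrier A0 A1 f ->
  0 < t -> ((d1 t * g f t)%:E <= C%:E * N1 f)%E.
Proof.
have [M M0 hM] := mnorm_le_amnorm hr1.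
have [C C0 hC] := amnorm_le_mnorm hr1.
have [D D0 hD] := slow_le slow_h (@ltr01 R).
have [F F0 hF] := Q_lower.
exists (M * (C * (D * expR 1 * F))) => [|f t sf t0].
  by rewrite !mulr_gt0 ?expR_gt0.
have := g_ge0 t0 sf; rewrite le_eqVlt => /predU1P[<-|gt0].
  by rewrite mulr0 mule_ge0 ?Lnorm_ge0// lee_fin !mulr_ge0 ?expR_ge0// ltW.
set E := D * expR 1 * F; have E0 : 0 < E by rewrite !mulr_gt0 ?expR_gt0.
have Q0 s : (0 <= Q f s)%E by exact: Lnorm_ge0.
have key : (amnorm r1 (tail h negatives t) <= (C * (E / g f t))%:E * N1 f)%E.
  rewrite interpR1_normE; apply: hC => [||u u0|x y x0 y0 xy].
  - by rewrite divr_gt0.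
  - exact: tail_ge0.
  - by rewrite mule_ge0// lee_fin ltW// h_gt0.
  rewrite patchE; case: ifPn => [/set_mem[_ Px]|_]; last first.
    apply: mule_ge0; first by rewrite lee_fin divr_ge0// ltW.
    by apply: mule_ge0 => //; rewrite lee_fin ltW// h_gt0.
  have hQ : ((g f t)%:E <= F%:E * Q f y)%E.
    apply: hF => //; move: Px; rewrite /negatives/=.
    by move: xy; rewrite ler_norml; lra.
  apply: (@le_trans _ _ ((D * expR 1 / g f t)%:E * (h y)%:E * (g f t)%:E)%E).
    rewrite -!EFinM lee_fin [leRHS](_ : _ = D * expR 1 * h y); last first.
      by field; rewrite gt_eqF.
    apply: le_trans (hD x y x0 y0) _; rewrite mul1r.
    by rewrite ler_wpM2r ?(ltW (h_gt0 y0))// ler_wpM2l ?(ltW D0)// ler_expR.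
  apply: le_trans (lee_wpmul2l _ hQ) _.
    rewrite -EFinM lee_fin mulr_ge0 ?(ltW (h_gt0 y0))//.
    by apply: divr_ge0; [apply: mulr_ge0; [exact: ltW|exact: expR_ge0]|exact: ltW].
  rewrite !muleA -!EFinM; apply: lee_wpmul2r => //.
  rewrite lee_fin le_eqVlt; apply/orP; left; apply/eqP; rewrite /E; field.
  by rewrite gt_eqF.
rewrite EFinM -(mnorm_d1 t0) muleC.
have hm := hM _ (tail_ge0 negatives t h_gt0).
apply: (@le_trans _ _ ((g f t)%:E * (M%:E * ((C * (E / g f t))%:E * N1 f)))%E).
  apply: lee_wpmul2l; first by rewrite lee_fin ltW.
  apply: le_trans hm _; apply: lee_wpmul2l => //.
  by rewrite lee_fin ltW.
rewrite !muleA -!EFinM; apply: lee_wpmul2r; first exact: Lnorm_ge0.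
rewrite lee_fin le_eqVlt; apply/orP; left; apply/eqP; field.
by rewrite gt_eqF.
Qed.

Let c1_gt0 t : 0 < t -> 0 < c1 t.
Proof. by move=> t0; apply: mulr_gt0; [exact: a1_gt0|exact: d1_gt0]. Qed.

Let rho_gt0 : positive_fun rho.
Proof. exact: (@power_like_gt0 R rho kappa theta1). Qed.

Let ln_rho t : 0 < t -> ln (rho t) = theta1 * ln t + (ln (c0 t) - ln (c1 t)).
Proof.
move=> t0; rewrite (@ln_power_like R rho kappa theta1)//.
by rewrite /kappa ln_div ?posrE ?c0_gt0 ?c1_gt0.
Qed.

(** * Lower bound for the K-functional of the couple [Y0], [Y1] *)

Local Notation KY := (Kfun Y0 Y1).

Let nnY0 : nonneg_qnorm Y0. Proof. exact: nonneg_interp. Qed.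
Let nnY1 : nonneg_qnorm Y1. Proof. exact: nonneg_interpR. Qed.

Let sum_Y f : sum_carrier Y0 Y1 f -> sum_carrier A0 A1 f.
Proof. by move=> [f0 [f1 [[s0 _] [s1 _] ->]]]; exact: sum_carrierD. Qed.

Lemma KY_lower : exists2 C : R, 0 < C & forall f t, sum_carrier Y0 Y1 f ->
  0 < t -> c0 t * K t f <= C * KY (rho t) f.
Proof.
have [Ca Ca0 hCa] := N0_lower; have [Cb Cb0 hCb] := N1_lower.
have [Ct Ct0 hCt] := Kfun_triangle hA.
pose C := Ct * (Ca + Cb); have C0 : 0 < C by rewrite mulr_gt0 ?addr_gt0.
exists C => // f t sf t0; rewrite -ler_pdivrMl//.
apply: le_Kfun => // f0 f1 cf0 cf1 ->; rewrite ler_pdivrMl//.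
have [s0 _] := cf0; have [s1 _] := cf1; have r0' := rho_gt0 t0.
have h0 : c0 t * K t f0 <= Ca * qnorm Y0 f0.
  by rewrite -lee_fin [leRHS]EFinM (interp_qnormE cf0); exact: hCa.
have h1 : d1 t * g f1 t <= Cb * qnorm Y1 f1.
  by rewrite -lee_fin [leRHS]EFinM (interpR_qnormE cf1); exact: hCb.
(* The definition of rho amounts to this identity, which turns the bound for [Y1] into one with the
   weight c0. *)
have gE : c0 t * K t f1 = rho t * (d1 t * g f1 t).
  rewrite /rho /g /c1 powRN; field.
  by rewrite !gt_eqF ?powR_gt0 ?a1_gt0 ?d1_gt0.
have n0 := nnY0 cf0; have n1 := nnY1 cf1.
apply: (@le_trans _ _ (c0 t * (Ct * (K t f0 + K t f1)))).
  by rewrite ler_wpM2l ?(ltW (c0_gt0 t0))// hCt// ltW.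
have h1' : rho t * (d1 t * g f1 t) <= rho t * (Cb * qnorm Y1 f1).
  by rewrite ler_wpM2l// ltW.
rewrite [leLHS](_ : _ = Ct * (c0 t * K t f0 + c0 t * K t f1)); last by ring.
rewrite /C -mulrA ler_pM2l// gE; apply: le_trans (lerD h0 h1') _.
have p1 : 0 <= Cb * qnorm Y0 f0 by rewrite mulr_ge0// ltW.
have p2 : 0 <= Ca * (rho t * qnorm Y1 f1).
  by rewrite mulr_ge0 ?(ltW Ca0)// mulr_ge0// ltW.
by nra.
Qed.

(** * Embedding of the left-hand space into the right-hand one *)

Let w (t : R) := rho t `^ (- theta) * a (rho t).
Let eta := theta * theta1.
Let asharp (t : R) := c0 t `^ (1 - theta) * c1 t `^ theta * a (rho t).
(** [G f] and [H f] are the integrands, for dt/t, of the right-hand and left-hand norms. *)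
Let G f (t : R) := t `^ (- eta) * asharp t * K t f.
Let H f (u : R) := u `^ (- theta) * a u * KY u f.

Let w_gt0 : positive_fun w.
Proof.
by move=> t t0; apply: mulr_gt0; [exact/powR_gt0/rho_gt0|exact/a_gt0/rho_gt0].
Qed.

Let GE f t : 0 < t -> G f t = w t * (c0 t * K t f).
Proof.
move=> t0; rewrite mulrA; congr (_ * _).
have e1 : t `^ (- eta) * (c0 t `^ (1 - theta) * c1 t `^ theta) =
    rho t `^ (- theta) * c0 t.
  rewrite (powR_expR _ t0) !(powR_expR _ (c0_gt0 t0)).
  rewrite (powR_expR _ (c1_gt0 t0)) (powR_expR _ (rho_gt0 t0)) ln_rho//.
  rewrite -[X in _ = _ * X]lnK ?posrE ?c0_gt0// -!expRD; congr expR.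
  by rewrite /eta; ring.
by rewrite /asharp /w mulrA e1; ring.
Qed.

Let G_ge0 f t : sum_carrier A0 A1 f -> 0 < t -> 0 <= G f t.
Proof.
move=> sf t0; rewrite GE// mulr_ge0 ?(ltW (w_gt0 t0))//.
by rewrite mulr_ge0 ?(ltW (c0_gt0 t0))// K_ge0.
Qed.

Let H_ge0 f u : sum_carrier Y0 Y1 f -> 0 < u -> 0 <= H f u.
Proof.
move=> sf u0; apply: mulr_ge0; last by apply: Kfun_ge0 => //; exact: ltW.
by apply: mulr_ge0; [exact: powR_ge0|exact/ltW/a_gt0].
Qed.

Lemma embedding_into_asharp : exists2 C : R, 0 < C & forall f,
  sum_carrier Y0 Y1 f -> sum_carrier A0 A1 f /\
  (interp_norm A0 A1 eta r asharp f <= C%:E * interp_norm Y0 Y1 theta r a f)%E.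
Proof.
have [M M0 hM] := mnorm_le_amnorm hr.
have [C C0 hC] := amnorm_schur hr (@ltr01 R).
have [D D0 hD] := amnorm_le_mnorm hr.
have [E E0 hE] := KY_lower.
have [F F0 hF] := slow_Kfun_le (- theta) nnY0 nnY1 slow_a.
have [N N0' hN] := power_like_lower htheta1 slow_kappa (fun t _ => erefl (rho t)).
have /andP[th10 _] := htheta1.
(* By [power_like_lower], points whose images under rho share a block are within logarithmic
   distance L. *)
pose L := (N + 1) / (theta1 / 2).
pose F' := F * expR ((`|- theta| + 2) * 1).
have F'0 : 0 < F' by rewrite mulr_gt0// expR_gt0.
exists (M * (C * (E * expR L) * (D * F'))) => [|f sf].
  by rewrite !mulr_gt0// expR_gt0.
have sAf := sum_Y sf; split=> //.
have G0 : nonneg_fun (EFin \o G f) by move=> t t0; rewrite lee_fin G_ge0.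
have H0 : nonneg_fun (EFin \o H f) by move=> t t0; rewrite lee_fin H_ge0.
rewrite !interp_normE; apply: le_trans (hM _ G0) _.
rewrite -mulrA EFinM -[leRHS]muleA; apply: lee_wpmul2l.
  by rewrite lee_fin ltW.
(* A chosen point that rho sends into block j, or 1 if there is none; only the block of rho(t) is
   used, where t itself is a witness. *)
pose l (j : int) := ln (xget 1 [set t | 0 < t /\ lfloor (rho t) = j]).
apply: (@le_trans _ _ ((C * (E * expR L))%:E * amnorm r (EFin \o H f))%E).
  apply: (hC l) => // [|t B t0 B0 hB]; first by rewrite mulr_gt0// expR_gt0.
  have r0' := rho_gt0 t0.
  pose t' := xget 1 [set t' | 0 < t' /\ lfloor (rho t') = lfloor (rho t)].
  have [t'0 ft'] : [set t' | 0 < t' /\ lfloor (rho t') = lfloor (rho t)] t'.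
    by apply: xgetPex; exists t.
  have dtt : `|ln t - ln t'| <= L.
    rewrite /L ler_pdivlMr ?divr_gt0// mulrC.
    apply: le_trans (hN t t' t0 t'0) _; rewrite lerD2l.
    by apply: same_block_dist => //; exact: rho_gt0.
  have := hB (rho t) r0'; rewrite /l -/t' /= => hBr.
  have GH : G f t <= E * H f (rho t).
    rewrite GE// [leRHS](_ : _ = w t * (E * KY (rho t) f)).
      by rewrite ler_pM2l ?w_gt0// hE.
    by rewrite /H /w; ring.
  apply: (@le_trans _ _ ((E * expR L)%:E *
      ((expR (- 1 * `|ln t - ln t'|))%:E * (H f (rho t))%:E))%E).
    rewrite -!EFinM lee_fin /=; apply: le_trans GH _.
    rewrite -mulrA ler_pM2l// mulrA -expRD ler_peMl ?H_ge0//.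
    by rewrite -[leLHS]expR0 ler_expR; lra.
  by apply: lee_wpmul2l => //; rewrite lee_fin mulr_ge0 ?expR_ge0// ltW.
rewrite [X in (_ <= X%:E * _)%E](_ : _ = C * (E * expR L) * (D * F')); last by ring.
rewrite [X in (_ <= X * _)%E]EFinM -[leRHS]muleA; apply: lee_wpmul2l.
  by rewrite lee_fin !mulr_ge0 ?expR_ge0// ltW.
apply: hD => // s t s0 t0 st; rewrite -EFinM lee_fin.
apply: le_trans (hF f s t sf s0 t0) _.
rewrite ler_wpM2r ?H_ge0// ler_wpM2l ?(ltW F0)// ler_expR ler_wpM2l//.
Qed.

(** * The slow factor [v] of [w], and the choice of a rate of decay *)

Let v (t : R) := kappa t `^ (- theta) * a (rho t).

Let slow_v : slow v.
Proof.
apply: slowM; first exact: slow_powR.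
have [M M0 hM] := power_like_upper htheta1 slow_kappa (fun t _ => erefl (rho t)).
by apply: (slow_comp slow_a rho_gt0 _ M0 hM).
Qed.

Let wE t : 0 < t -> w t = t `^ (- eta) * v t.
Proof.
move=> t0; have [k0 _] := slow_kappa.
rewrite /w /v mulrA; congr (_ * _); rewrite /rho powRM ?powR_ge0 ?(ltW (k0 t t0))//.
by rewrite -powRrM; congr (_ `^ _ * _); rewrite /eta; ring.
Qed.

(** The exponent of the power in w rho; it equals theta1 (1 - theta), hence is positive. *)
Let eta' := theta1 - eta.

(** Each power must pay for at most two losses of rate d, one from a slow factor and one from the
    growth allowed to G, and still leave decay of rate d. *)
Lemma exists_rate : exists2 d : R, 0 < d &
  [/\ 3 * d <= eta, 3 * d <= eta' & 3 * d <= 1 - theta1].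
Proof.
have /andP[t0 t1] := htheta; have /andP[s0 s1] := htheta1.
have e0 : 0 < eta by rewrite mulr_gt0.
have e'0 : 0 < eta' by rewrite /eta' /eta; nra.
pose m := Num.min eta (Num.min eta' (1 - theta1)).
have m0 : 0 < m by rewrite !lt_min e0 e'0 subr_gt0 s1.
have m3 : 3 * (m / 3) = m by field.
exists (m / 3); first by rewrite divr_gt0.
by rewrite m3 /m !ge_min !lexx !orbT.
Qed.

Let w_inv_le (e : R) : 0 < e -> exists2 C : R, 0 < C & forall s t : R,
  0 < s -> 0 < t -> (w s)^-1 <=
  C * expR (eta * (ln s - ln t) + e * `|ln s - ln t|) * (w t)^-1.
Proof.
move=> e0; have [C C0 hC] := slow_powR_le eta (slowV slow_v) e0.
exists C => // s t s0 t0; have := hC s t s0 t0.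
have wVE x : 0 < x -> (w x)^-1 = x `^ eta * (v x)^-1.
  by move=> x0; rewrite wE// invfM -powRN opprK.
by rewrite !wVE.
Qed.

(** Used with [b] equal to [d1] for the inner norm of [Y1] and to 1 for the outer one. *)
Let wrho_inv_le (e : R) (b : R -> R) : 0 < e -> slow b ->
  exists2 C : R, 0 < C & forall s t : R, 0 < s -> 0 < t ->
  (w s * rho s * b s)^-1 <=
  C * expR (- eta' * (ln s - ln t) + e * `|ln s - ln t|) *
  (w t * rho t * b t)^-1.
Proof.
move=> e0 sb.
have svkb := slowM (slowM slow_v slow_kappa) sb.
have [C C0 hC] := slow_powR_le (- eta') (slowV svkb) e0.
exists C => // s t s0 t0; have := hC s t s0 t0.
have wVE x : 0 < x ->
    (w x * rho x * b x)^-1 = x `^ (- eta') * (v x * kappa x * b x)^-1.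
  move=> x0; rewrite powRN -invfM wE//; congr (_^-1).
  rewrite (_ : eta' = - eta + theta1); last by rewrite /eta' addrC.
  by rewrite powRD ?(gt_eqF x0)/= ?implybT// /rho /kappa; ring.
by rewrite !wVE.
Qed.

(** * Upper bounds for the parts of an almost optimal splitting at t *)

Section Decomposition.
Variable d : R.
Hypotheses (d0 : 0 < d) (d_eta : 3 * d <= eta) (d_eta' : 3 * d <= eta')
  (d_theta1 : 3 * d <= 1 - theta1).

Let dominated f (t B : R) :=
  forall s, 0 < s -> G f s <= B * expR (d * `|ln s - ln t|).

(** Below t, b0 K(u, f0) is at most a multiple of c0 K(u, f) = G(u)/w(u), which decays away from t.
    Above t, K(u, f0) <= 2 K(t, f), and the tail of [b0] contributes c0(t). *)
Lemma N0_upper : exists2 C : R, 0 < C & forall f f0 f1 (t B : R),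
  0 < t -> 0 <= B -> near_optimal A0 A1 t f f0 f1 -> dominated f t B ->
  (N0 f0 <= (C * (B / w t))%:E)%E.
Proof.
have [M M0 hM] := mnorm_le_amnorm hr0.
have [Cm Cm0 hCm] := amnorm_max hr0.
have [Cg Cg0 hCg] := amnorm_geometric hr0 d0.
have [Cp Cp0 hCp] := Kfun_parts hA.
have [Cb Cb0 hCb] := b0_le; have [Ca Ca0 hCa] := amnorm_c0.
have [Cw Cw0 hCw] := w_inv_le d0.
exists (M * (Cm * (Cg * (Cb * (3 * Cp) * Cw) + 2 * Ca))).
  by rewrite !mulr_gt0// addr_gt0// !mulr_gt0.
move=> f f0 f1 t B t0 B0 [cf0 cf1 fE n0 n1] domB.
have sf : sum_carrier A0 A1 f by exists f0, f1.
have sf0 := sum_carrier0l hA cf0.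
have wt0 := w_gt0 t0; have Kt0 := K_ge0 t0 sf.
pose Z := B / w t; have Z0 : 0 <= Z by rewrite divr_ge0// ltW.
rewrite interp0_normE.
have bK0 : nonneg_fun (fun u => (b0 u * K u f0)%:E).
  by move=> u u0; rewrite lee_fin mulr_ge0 ?K_ge0 ?(ltW (b0_gt0 u0)).
have P1 : 0 < Cg * (Cb * (3 * Cp) * Cw) by rewrite !mulr_gt0.
have P2 : 0 < 2 * Ca by rewrite mulr_gt0.
apply: le_trans (hM _ bK0) _; rewrite -[in leRHS]mulrA [leRHS]EFinM.
apply: lee_wpmul2l; first by rewrite lee_fin ltW.
rewrite -mulrA [leRHS]EFinM.
pose X := Cb * (3 * Cp) * Cw * Z.
have X0 : 0 <= X by rewrite mulr_ge0// ltW// !mulr_gt0.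
pose g1 (u : R) := (expR (- d * `|ln u - ln t|) * X)%:E.
pose g2 := fun u => ((2 * K t f)%:E * tail b0 positives t u)%E.
have g20 : nonneg_fun g2.
  by move=> u u0; rewrite mule_ge0 ?lee_fin ?mulr_ge0//; exact: tail_ge0.
have cK : c0 t * K t f <= Z.
  rewrite /Z ler_pdivlMr// mulrC -GE//.
  by have := domB t t0; rewrite subrr normr0 mulr0 expR0 mulr1.
apply: (hCm _ g1 g2) => // [||u u0||].
- by rewrite lee_fin mulr_ge0// ltW// addr_gt0.
- by move=> u u0; rewrite lee_fin mulr_ge0// expR_ge0.
- have Ku0 := K_ge0 u0 sf.
  have [h1 _] := hCp u f0 f1 (ltW u0) cf0 cf1; rewrite -fE in h1.
  have [ut|tu] := leP u t; [left|right]; last first.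
    rewrite /g2 tail_in//; last first.
      by rewrite /positives/= subr_gt0 ltr_ln.
    rewrite /= -EFinM lee_fin mulrC ler_wpM2r ?(ltW (b0_gt0 u0))//.
    exact: le_trans (Kfun_left hA (ltW u0) cf0) n0.
  have lut : ln u <= ln t by rewrite ler_ln ?posrE.
  have h2 := Kfun_ratio nn0 nn1 sf u0 ut.
  have h3 : K u f0 <= 3 * Cp * K u f.
    (* Near-optimality at t is carried down to u <= t because K(u, f)/u is nonincreasing. *)
    have n1' : u * qnorm A1 f1 <= 2 * K u f.
      rewrite -(ler_pM2l (divr_gt0 t0 u0)).
      rewrite (_ : t / u * (u * _) = t * qnorm A1 f1); last by field; rewrite gt_eqF.
      by apply: le_trans n1 _; rewrite mulrCA ler_pM2l.
    apply: le_trans h1 _; rewrite [leRHS](_ : _ = Cp * (3 * K u f)).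
      by rewrite ler_pM2l//; lra.
    by ring.
  have hb := hCb u u0.
  have cKE : c0 u * K u f = (w u)^-1 * G f u.
    by rewrite GE// mulKf// gt_eqF// w_gt0.
  have hw := hCw u t u0 t0.
  have hG := domB u u0.
  have exps : expR (eta * (ln u - ln t) + d * `|ln u - ln t|) *
      expR (d * `|ln u - ln t|) <= expR (- d * `|ln u - ln t|).
    rewrite -expRD ler_expR distrC (ger0_norm (_ : 0 <= ln t - ln u)) ?subr_ge0//.
    have x0 : 0 <= ln t - ln u by rewrite subr_ge0.
    by have := ler_wpM2r x0 d_eta; lra.
  rewrite /g1 lee_fin.
  apply: (@le_trans _ _ (Cb * c0 u * (3 * Cp * K u f))).
    by apply: ler_pM => //; [exact/ltW/b0_gt0|exact: K_ge0].
  rewrite [leLHS](_ : _ = Cb * (3 * Cp) * (c0 u * K u f)); last by ring.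
  rewrite cKE /X [leRHS](_ : _ = Cb * (3 * Cp) *
    (Cw * expR (- d * `|ln u - ln t|) * Z)); last by ring.
  rewrite ler_pM2l ?mulr_gt0//.
  apply: le_trans (ler_pM _ _ hw hG) _; rewrite ?G_ge0//.
    by rewrite invr_ge0 ltW// w_gt0.
  rewrite /Z [leLHS](_ : _ = Cw * (expR (eta * (ln u - ln t) + d * `|ln u - ln t|) *
      expR (d * `|ln u - ln t|)) * (B / w t)); last by ring.
  by rewrite ler_wpM2r// ler_pM2l.
- apply: le_trans (hCg (ln t) g1 X%:E _ _ _) _ => //.
  + by move=> u u0; rewrite lee_fin mulr_ge0// expR_ge0.
  rewrite -EFinM lee_fin [leRHS](_ : _ = Cg * X + 2 * Ca * Z).
    by rewrite lerDl mulr_ge0// ltW.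
  by rewrite /X /Z; ring.
apply: (@le_trans _ _ ((2 * K t f)%:E * amnorm r0 (tail b0 positives t))%E).
  apply: amnorm_le_scale => //; first by rewrite mulr_ge0.
  exact: tail_ge0.
apply: le_trans (lee_wpmul2l _ (hCa t t0)) _; first by rewrite lee_fin mulr_ge0.
rewrite -EFinM lee_fin [leRHS](_ : _ = Cg * X + 2 * Ca * Z); last first.
  by rewrite /X /Z; ring.
rewrite [leLHS](_ : _ = 2 * Ca * (c0 t * K t f)); last by ring.
apply: (@le_trans _ _ (2 * Ca * Z)); first by rewrite ler_pM2l.
by rewrite lerDr mulr_ge0// ltW.
Qed.

(** The weight with g f = G f / W. *)
Let W (t : R) := w t * rho t * d1 t.

Let W_gt0 : positive_fun W.
Proof.
move=> t t0; apply: mulr_gt0; last exact: d1_gt0.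
by apply: mulr_gt0; [exact: w_gt0|exact: rho_gt0].
Qed.

Let gGE f u : 0 < u -> g f u = (W u)^-1 * G f u.
Proof.
move=> u0; rewrite GE// /g /W.
have w0 := w_gt0 u0; have c00 := c0_gt0 u0; have p0 := powR_gt0 theta1 u0.
have a10 := a1_gt0 u0; have d10 := d1_gt0 u0.
rewrite /rho /c1 powRN; field.
by rewrite !gt_eqF.
Qed.

(** Past t, |f0| <= 2 K(t, f) <= 2 K(u, f), so f1 is controlled by f. The decay is centred at s,
    where the inner norm starts; e^(d |ln s - ln t|) is the growth allowed to G up to there. *)
Lemma g_upper_right : exists2 C : R, 0 < C & forall f f0 f1 (t B s u : R),
  0 < t -> 0 <= B -> near_optimal A0 A1 t f f0 f1 -> dominated f t B ->
  t <= s -> s < u ->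
  g f1 u <= C * (B * expR (d * `|ln s - ln t|) / W s) *
    expR (- d * `|ln u - ln s|).
Proof.
have [Cp Cp0 hCp] := Kfun_parts hA.
have [Cw Cw0 hCw] := wrho_inv_le d0 slow_d1.
exists (3 * Cp * Cw) => [|f f0 f1 t B s u t0 B0 [cf0 cf1 fE n0 n1] domB ts su].
  by rewrite !mulr_gt0.
have s0 : 0 < s by exact: lt_le_trans ts.
have u0 : 0 < u by exact: lt_trans su.
have tu : t <= u by rewrite (le_trans ts)// ltW.
have sf : sum_carrier A0 A1 f by exists f0, f1.
have [_ h1] := hCp u f0 f1 (ltW u0) cf0 cf1; rewrite -fE in h1.
have h2 := Kfun_homo nn0 nn1 sf (ltW t0) tu.
have h3 : K u f1 <= 3 * Cp * K u f.
  apply: le_trans h1 _; rewrite [leRHS](_ : _ = Cp * (3 * K u f)).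
    by rewrite ler_pM2l//; lra.
  by ring.
have pu : 0 < u `^ (- theta1) * a1 u by rewrite mulr_gt0 ?powR_gt0 ?a1_gt0.
have h4 : g f1 u <= 3 * Cp * ((W u)^-1 * G f u).
  rewrite -gGE// /g [leRHS](_ : _ = u `^ (- theta1) * a1 u * (3 * Cp * K u f)).
    by rewrite ler_pM2l.
  by ring.
apply: le_trans h4 _.
have hw := hCw u s u0 s0; rewrite -/(W u) -/(W s) in hw.
have hG := domB u u0.
have lts : ln t <= ln s by rewrite ler_ln ?posrE.
have lsu : ln s <= ln u by rewrite ler_ln ?posrE// ltW.
rewrite -(mulrA (3 * Cp)) -(mulrA (3 * Cp)) ler_pM2l ?mulr_gt0//.
apply: le_trans (ler_pM _ _ hw hG) _; rewrite ?G_ge0//.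
  by rewrite invr_ge0 ltW// W_gt0.
rewrite [leLHS](_ : _ = Cw * (B / W s) *
  (expR (- eta' * (ln u - ln s) + d * `|ln u - ln s|) *
   expR (d * `|ln u - ln t|))); last by ring.
rewrite [leRHS](_ : _ = Cw * (B / W s) *
  (expR (d * `|ln s - ln t|) * expR (- d * `|ln u - ln s|))); last by ring.
rewrite ler_wpM2l//.
  by rewrite mulr_ge0 ?(ltW Cw0)// divr_ge0// ltW// W_gt0.
rewrite -!expRD ler_expR !ger0_norm ?subr_ge0// ?(le_trans lts)//.
have x0 : 0 <= ln u - ln s by rewrite subr_ge0.
by have := ler_wpM2r x0 d_eta'; lra.
Qed.

(** Below t, K(u, f1) <= u |f1| <= 2 (u/t) K(t, f), and u^(1 - theta1) a1(u) decays as u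
    decreases. *)
Lemma g_upper_left : exists2 C : R, 0 < C & forall f f0 f1 (t B u : R),
  0 < t -> 0 <= B -> near_optimal A0 A1 t f f0 f1 -> dominated f t B ->
  0 < u -> u <= t -> g f1 u <= C * (B / W t) * expR (- d * `|ln u - ln t|).
Proof.
have [Ca Ca0 hCa] := slow_powR_le (1 - theta1) slow_a1 d0.
exists (2 * Ca) => [|f f0 f1 t B u t0 B0 [cf0 cf1 fE n0 n1] domB u0 ut].
  by rewrite mulr_gt0.
have sf : sum_carrier A0 A1 f by exists f0, f1.
have Kt0 := K_ge0 t0 sf.
have h1 : K u f1 <= u / t * (2 * K t f).
  apply: le_trans (Kfun_right hA (ltW u0) cf1) _.
  rewrite (_ : u * _ = u / t * (t * qnorm A1 f1)); last by field; rewrite gt_eqF.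
  by rewrite ler_pM2l// divr_gt0.
have powS x : 0 < x -> x `^ (1 - theta1) = x * x `^ (- theta1).
  by move=> x0; rewrite powR_split// powRr1 ?ltW// mulrC.
have h2 := hCa u t u0 t0; rewrite !powS// in h2.
have pu : 0 < u `^ (- theta1) * a1 u by rewrite mulr_gt0 ?powR_gt0 ?a1_gt0.
apply: (@le_trans _ _ (2 * (u * u `^ (- theta1) * a1 u) * (K t f / t))).
  rewrite /g [leRHS](_ : _ = u `^ (- theta1) * a1 u * (u / t * (2 * K t f))).
    by rewrite ler_pM2l.
  by ring.
have Ktt : 0 <= K t f / t by rewrite divr_ge0// ltW.
apply: (@le_trans _ _ (2 * (Ca * expR ((1 - theta1) * (ln u - ln t) +
    d * `|ln u - ln t|) * (t * t `^ (- theta1) * a1 t)) * (K t f / t))).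
  by rewrite ler_wpM2r// ler_pM2l.
rewrite [leLHS](_ : _ = 2 * Ca * (expR ((1 - theta1) * (ln u - ln t) +
    d * `|ln u - ln t|) * g f t)); last by rewrite /g; field; rewrite gt_eqF.
rewrite -[leRHS]mulrA ler_pM2l ?mulr_gt0// mulrC.
have hg : g f t <= B / W t.
  rewrite gGE// mulrC ler_wpM2r//; first by rewrite invr_ge0 ltW// W_gt0.
  by have := domB t t0; rewrite subrr normr0 mulr0 expR0 mulr1.
apply: ler_pM; rewrite ?expR_ge0 ?g_ge0//.
have x0 : 0 <= ln t - ln u by rewrite subr_ge0 ler_ln ?posrE.
rewrite ler_expR distrC (ger0_norm x0).
by have := ler_wpM2r x0 d_theta1; have := mulr_ge0 (ltW d0) x0; lra.
Qed.

(** The inner integrand peaks at the larger of s and t and decays geometrically from there. *)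
Lemma Q_upper : exists2 C : R, 0 < C & forall f f0 f1 (t B s : R),
  0 < t -> 0 <= B -> near_optimal A0 A1 t f f0 f1 -> dominated f t B -> 0 < s ->
  (t <= s -> (Q f1 s <= (C * (B * expR (d * `|ln s - ln t|) / W s))%:E)%E) /\
  (s <= t -> (Q f1 s <= (C * (B / W t))%:E)%E).
Proof.
have [M M0 hM] := mnorm_le_amnorm hq1.
have [Cg Cg0 hCg] := amnorm_geometric hq1 d0.
have [C1 C10 hC1] := g_upper_right; have [C2 C20 hC2] := g_upper_left.
pose C := C1 + C2; have C0 : 0 < C by rewrite addr_gt0.
exists (M * (Cg * C)) => [|f f0 f1 t B s t0 B0 opt domB s0].
  by rewrite !mulr_gt0.
have [cf0 cf1 fE n0 n1] := opt.
have sf1 := sum_carrier0r hA cf1.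
have key (l Z : R) : 0 <= Z ->
    (forall u, s < u -> g f1 u <= C * Z * expR (- d * `|ln u - l|)) ->
    (Q f1 s <= (M * (Cg * C) * Z)%:E)%E.
  move=> Z0 hZ; apply: le_trans (hM _ (tail_g_ge0 positives s sf1)) _.
  rewrite -!mulrA [leRHS]EFinM; apply: lee_wpmul2l; first by rewrite lee_fin ltW.
  rewrite EFinM; apply: (hCg l) => [||u u0].
  - by rewrite lee_fin mulr_ge0// ltW.
  - exact: tail_g_ge0.
  rewrite patchE; case: ifPn => [/set_mem[_ su]|_]; last first.
    by rewrite lee_fin mulr_ge0 ?expR_ge0// mulr_ge0// ltW.
  rewrite lee_fin /= mulrC; apply: hZ.
  by rewrite -ltr_ln ?posrE// -subr_gt0.
have W0 x : 0 < x -> 0 <= B / W x by move=> x0; rewrite divr_ge0// ltW// W_gt0.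
split=> [ts|st].
  have Z0 : 0 <= B * expR (d * `|ln s - ln t|) / W s.
    by rewrite mulrAC mulr_ge0 ?W0// expR_ge0.
  apply: (key (ln s)) => // u su.
  apply: le_trans (hC1 f f0 f1 t B s u t0 B0 opt domB ts su) _.
  rewrite ler_wpM2r ?expR_ge0// ler_wpM2r//.
  by rewrite /C lerDl ltW.
apply: (key (ln t)) => [|u su]; first exact: W0.
have u0 : 0 < u by exact: lt_trans su.
have [ut|tu] := leP u t.
  apply: le_trans (hC2 f f0 f1 t B u t0 B0 opt domB u0 ut) _.
  rewrite ler_wpM2r ?expR_ge0// ler_wpM2r ?W0//.
  by rewrite /C lerDr ltW.
(* Beyond t the right-hand bound is used with its centre s placed at t. *)
have := hC1 f f0 f1 t B t u t0 B0 opt domB (lexx t) tu.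
rewrite subrr normr0 mulr0 expR0 mulr1 => /le_trans; apply.
rewrite ler_wpM2r ?expR_ge0// ler_wpM2r ?W0//.
by rewrite /C lerDl ltW.
Qed.

(** For s >= t, h <= C d1 cancels the factor d1 of W and leaves 1/(w rho), which decays. For s < t
    the inner norm is at most C B/W(t), and the norm of [h] over (0, t) cancels d1(t). *)
Lemma N1_upper : exists2 C : R, 0 < C & forall f f0 f1 (t B : R),
  0 < t -> 0 <= B -> near_optimal A0 A1 t f f0 f1 -> dominated f t B ->
  (N1 f1 <= (C * (B / (w t * rho t)))%:E)%E.
Proof.
have [M M0 hM] := mnorm_le_amnorm hr1.
have [Cm Cm0 hCm] := amnorm_max hr1.
have [Cg Cg0 hCg] := amnorm_geometric hr1 d0.
have [Cq Cq0 hCq] := Q_upper.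
have [Ch Ch0 hCh] := h_le; have [Cd Cd0 hCd] := amnorm_d1.
have slow1 : slow (fun=> 1 : R).
  split=> [//|e e0].
  by exists 0 => // s t s0 t0; rewrite subrr normr0 add0r mulr_ge0// ltW.
have [Cw Cw0 hCw] := wrho_inv_le d0 slow1.
have P1 : 0 < Cg * (Ch * Cq * Cw) by rewrite !mulr_gt0.
have P2 : 0 < Cq * Cd by rewrite mulr_gt0.
exists (M * (Cm * (Cg * (Ch * Cq * Cw) + Cq * Cd))).
  by rewrite !mulr_gt0// addr_gt0.
move=> f f0 f1 t B t0 B0 opt domB.
have [cf0 cf1 fE n0 n1] := opt; have sf1 := sum_carrier0r hA cf1.
have wr0 x : 0 < x -> 0 < w x * rho x.
  by move=> x0; apply: mulr_gt0; [exact: w_gt0|exact: rho_gt0].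
pose Z := B / (w t * rho t); have Z0 : 0 <= Z by rewrite divr_ge0// ltW// wr0.
rewrite interpR1_normE.
have hQ0 : nonneg_fun (fun s => ((h s)%:E * Q f1 s)%E).
  by move=> s s0; rewrite mule_ge0 ?mnorm_ge0// lee_fin ltW// h_gt0.
apply: le_trans (hM _ hQ0) _; rewrite -[in leRHS]mulrA [leRHS]EFinM.
apply: lee_wpmul2l; first by rewrite lee_fin ltW.
rewrite -mulrA [leRHS]EFinM.
pose X := Ch * Cq * Cw * Z.
have X0 : 0 <= X by rewrite mulr_ge0// ltW// !mulr_gt0.
pose g1 (u : R) := (expR (- d * `|ln u - ln t|) * X)%:E.
pose k := Cq * (B / W t).
have k0 : 0 <= k by rewrite mulr_ge0 ?(ltW Cq0)// divr_ge0// ltW// W_gt0.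
pose g2 := fun u => (k%:E * tail h negatives t u)%E.
have g20 : nonneg_fun g2.
  by move=> u u0; rewrite mule_ge0 ?lee_fin//; exact: tail_ge0.
have g10 : nonneg_fun g1.
  by move=> u u0; rewrite lee_fin mulr_ge0// expR_ge0.
apply: (hCm _ g1 g2) => // [|s s0||].
- by rewrite lee_fin mulr_ge0// ltW// addr_gt0.
- have [hts hst] := hCq f f0 f1 t B s t0 B0 opt domB s0.
  have hs0 : (0 <= (h s)%:E)%E by rewrite lee_fin ltW// h_gt0.
  have [ts|st] := leP t s; [left|right]; last first.
    rewrite /g2 tail_in//; last by rewrite /negatives/= subr_lt0 ltr_ln.
    by rewrite /= muleC; apply: lee_wpmul2r => //; exact/hst/ltW.
  apply: le_trans (lee_wpmul2l hs0 (hts ts)) _.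
  rewrite -EFinM lee_fin.
  have hw := hCw s t s0 t0; rewrite !mulr1 in hw.
  have hd := hCh s s0; have Ws := W_gt0 s0; have ds := d1_gt0 s0.
  have Z1 : 0 <= Cq * (B * expR (d * `|ln s - ln t|) / W s).
    exact: mulr_ge0 (ltW Cq0) (divr_ge0 (mulr_ge0 B0 (expR_ge0 _)) (ltW Ws)).
  apply: le_trans (ler_wpM2r Z1 hd) _.
  rewrite [leLHS](_ : _ = Ch * Cq * B * expR (d * `|ln s - ln t|) *
      (w s * rho s)^-1); last first.
    have := w_gt0 s0; have := rho_gt0 s0; rewrite /W => ? ?.
    by field; rewrite !gt_eqF.
  have Z2 : 0 <= Ch * Cq * B * expR (d * `|ln s - ln t|).
    by apply: mulr_ge0 (expR_ge0 _); apply: mulr_ge0 => //; rewrite ltW// mulr_gt0.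
  apply: le_trans (ler_wpM2l Z2 hw) _.
  rewrite [leLHS](_ : _ = (expR (d * `|ln s - ln t|) *
    expR (- eta' * (ln s - ln t) + d * `|ln s - ln t|)) * X); last first.
    by rewrite /X /Z; ring.
  rewrite ler_wpM2r// -expRD ler_expR.
  have x0 : 0 <= ln s - ln t by rewrite subr_ge0 ler_ln ?posrE.
  by rewrite (ger0_norm x0); have := ler_wpM2r x0 d_eta'; lra.
- apply: le_trans (hCg (ln t) g1 X%:E _ _ _) _ => //.
  rewrite -EFinM lee_fin [leRHS](_ : _ = Cg * X + Cq * Cd * Z).
    by rewrite lerDl mulr_ge0// ltW.
  by rewrite /X /Z; ring.
apply: (@le_trans _ _ (k%:E * amnorm r1 (tail h negatives t))%E).
  by apply: amnorm_le_scale => //; exact: tail_ge0.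
apply: le_trans (lee_wpmul2l _ (hCd t t0)) _; first by rewrite lee_fin.
rewrite -EFinM lee_fin [leRHS](_ : _ = Cg * X + Cq * Cd * Z); last first.
  by rewrite /X /Z; ring.
rewrite [leLHS](_ : _ = Cq * Cd * Z).
  by rewrite lerDr mulr_ge0// ltW.
have := w_gt0 t0; have := rho_gt0 t0; have := d1_gt0 t0.
by rewrite /k /Z /W => ? ? ?; field; rewrite !gt_eqF.
Qed.

(** One splitting gives both conclusions: the finite bounds put f0 in [Y0] and f1 in [Y1], and the
    weights w and w rho cancel in the estimate of K_Y. *)
Lemma KY_upper : exists2 C : R, 0 < C & forall f (t B : R),
  sum_carrier A0 A1 f -> 0 < t -> 0 <= B -> dominated f t B ->
  sum_carrier Y0 Y1 f /\ H f (rho t) <= C * B.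
Proof.
have [C0 C00 hC0] := N0_upper; have [C1 C10 hC1] := N1_upper.
exists (C0 + C1) => [|f t B sf t0 B0 domB]; first by rewrite addr_gt0.
have [f0 [f1 opt]] := couple_decomposition hA t0 sf.
have h0 := hC0 f f0 f1 t B t0 B0 opt domB.
have h1 := hC1 f f0 f1 t B t0 B0 opt domB.
have [cf0 cf1 fE _ _] := opt.
have y0 : carrier Y0 f0.
  by split; [exact: sum_carrier0l|exact: le_lt_trans h0 (ltry _)].
have y1 : carrier Y1 f1.
  by split; [exact: sum_carrier0r|exact: le_lt_trans h1 (ltry _)].
split; first by exists f0, f1.
have w0 := w_gt0 t0; have r0' := rho_gt0 t0.
rewrite -(interp_qnormE y0) lee_fin in h0.
rewrite -(interpR_qnormE y1) lee_fin in h1.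
rewrite /H -/(w t) fE.
apply: (@le_trans _ _ (w t * (qnorm Y0 f0 + rho t * qnorm Y1 f1))).
  by rewrite ler_pM2l// Kfun_le// ltW.
apply: (@le_trans _ _ (w t * (C0 * (B / w t) +
    rho t * (C1 * (B / (w t * rho t)))))).
  by rewrite ler_pM2l// lerD// ler_pM2l.
rewrite le_eqVlt; apply/orP; left; apply/eqP; field.
by rewrite !gt_eqF.
Qed.

End Decomposition.

(** * Embedding of the right-hand space into the left-hand one *)

Lemma embedding_of_asharp : exists2 C : R, 0 < C & forall f,
  sum_carrier A0 A1 f -> (interp_norm A0 A1 eta r asharp f < +oo)%E ->
  sum_carrier Y0 Y1 f /\
  (interp_norm Y0 Y1 theta r a f <= C%:E * interp_norm A0 A1 eta r asharp f)%E.
Proof.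
have [d d0 [d1' d2 d3]] := exists_rate.
have [E E0 hE] := KY_upper d0 d1' d2 d3.
have [M M0 hM] := mnorm_le_amnorm hr.
(* The rate is d/2 because [power_like_upper] has slope 2: distances between values of ln rho are at
   most doubled, which gives the rate d of [dominated]. *)
have [C C0 hC] := amnorm_schur hr (divr_gt0 d0 (@ltr0Sn R 1)).
have [D D0 hD] := amnorm_le_mnorm hr.
have [F F0 hF] := slow_Kfun_le (- theta) nnY0 nnY1 slow_a.
have slow_asharp : slow asharp.
  apply: slowM; last first.
    have [L L0 hL] := power_like_upper htheta1 slow_kappa (fun t _ => erefl (rho t)).
    by apply: (slow_comp slow_a rho_gt0 _ L0 hL).
  by apply: slowM; apply: slow_powR => //; exact: slowM.
have [S S0 hS] := slow_Kfun_le (- eta) nn0 nn1 slow_asharp.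
have [N N0' hN] := power_like_upper htheta1 slow_kappa (fun t _ => erefl (rho t)).
have [P P0 hP] := power_like_dense htheta1 slow_kappa (fun t _ => erefl (rho t)).
pose S' := S * expR ((`|- eta| + 2) * 1).
have S'0 : 0 < S' by rewrite mulr_gt0// expR_gt0.
pose T := F * expR ((`|- theta| + 2) * P) * E * expR (d / 2 * (P + N + N + 2)).
have T0 : 0 < T by rewrite !mulr_gt0 ?expR_gt0.
exists (M * (C * T * (D * S'))) => [|f sf].
  by apply: mulr_gt0 => //; apply: mulr_gt0; exact: mulr_gt0.
have G0 : nonneg_fun (EFin \o G f) by move=> t t0; rewrite lee_fin G_ge0.
have amG : (amnorm r (EFin \o G f) <= (D * S')%:E * interp_norm A0 A1 eta r asharp f)%E.
  rewrite interp_normE; apply: hD => // s t s0 t0 st; rewrite -EFinM lee_fin.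
  apply: le_trans (hS f s t sf s0 t0) _.
  by rewrite ler_wpM2r ?G_ge0// ler_wpM2l ?(ltW S0)// ler_expR ler_wpM2l.
move=> fin.
have am_fin : amnorm r (EFin \o G f) \is a fin_num.
  rewrite ge0_fin_numE ?amnorm_ge0//; apply: le_lt_trans amG _.
  by rewrite lte_mul_pinfty ?lee_fin ?(ltW (mulr_gt0 D0 S'0)).
(* A single point suffices for membership: at 1, G is dominated by its own finite [amnorm]. *)
have sY : sum_carrier Y0 Y1 f.
  have [] // := hE f 1 (fine (amnorm r (EFin \o G f))) sf ltr01.
    by rewrite fine_ge0// amnorm_ge0.
  move=> s s0; apply: (@le_trans _ _ (fine (amnorm r (EFin \o G f)))).
    by rewrite -lee_fin fineK//; exact: (amnorm_pt hr G0 s0).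
  rewrite ler_peMr ?fine_ge0 ?amnorm_ge0// -[leLHS]expR0 ler_expR.
  by rewrite mulr_ge0// ltW.
split=> //.
have H0 : nonneg_fun (EFin \o H f) by move=> t t0; rewrite lee_fin H_ge0.
rewrite [in leLHS]interp_normE; apply: le_trans (hM _ H0) _.
rewrite EFinM -[leRHS]muleA; apply: lee_wpmul2l; first by rewrite lee_fin ltW.
apply: (@le_trans _ _ ((C * T)%:E * amnorm r (EFin \o G f))%E); last first.
  rewrite [X in (_ <= X * _)%E]EFinM -[leRHS]muleA; apply: lee_wpmul2l => //.
  by rewrite lee_fin mulr_ge0// ltW.
pose l (j : int) := ln (rho (expR j%:~R)).
(* The bound B ranges over the extended reals; only a finite B needs work. *)
apply: (hC l) => // u [B||] // u0 B0 hB; last by rewrite gt0_muley ?leey ?lte_fin.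
rewrite lee_fin in B0; have [t t0 ht] := hP u u0.
have rt0 := rho_gt0 t0.
have domB s : 0 < s ->
    G f s <= B * expR (d / 2 * (P + N + N + 2)) * expR (d * `|ln s - ln t|).
  move=> s0; have := hB s s0; rewrite -EFinM lee_fin.
  rewrite mulNr expRN mulrC ler_pdivrMr ?expR_gt0// => /le_trans; apply.
  rewrite -mulrA -expRD ler_wpM2l// ler_expR.
  have e1 := hN s t s0 t0.
  have e2 := hN s (expR (lfloor s)%:~R) s0 (expR_gt0 _).
  have e3 := lfloor_dist s0; rewrite expRK in e2.
  (* P leads from u to rho(t), N + 2 |ln s - ln t| from rho(t) to rho(s), and N + 2 from rho(s) to
     the value of rho at the start of the block of s. *)
  have e4 : `|ln u - l (lfloor s)| <= P + N + N + 2 + 2 * `|ln s - ln t|.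
    apply: le_trans (ler_distD (ln (rho t)) _ _) _.
    have := ler_distD (ln (rho s)) (ln (rho t)) (l (lfloor s)).
    rewrite (distrC (ln (rho t)) (ln (rho s))) /l; lra.
  have d20 : 0 <= d / 2 by rewrite divr_ge0// ltW.
  by have := ler_wpM2l d20 e4; lra.
have B'0 : 0 <= B * expR (d / 2 * (P + N + N + 2)) by rewrite mulr_ge0// expR_ge0.
have [_ hH] := hE f t _ sf t0 B'0 domB.
rewrite -EFinM lee_fin.
apply: le_trans (hF f u (rho t) sY u0 rt0) _.
apply: (@le_trans _ _ (F * expR ((`|- theta| + 2) * P) * H f (rho t))).
  rewrite ler_wpM2r ?H_ge0// ler_wpM2l ?(ltW F0)// ler_expR ler_wpM2l//.
rewrite [leRHS](_ : _ = F * expR ((`|- theta| + 2) * P) *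
    (E * (B * expR (d / 2 * (P + N + N + 2))))); last by rewrite /T; ring.
by rewrite ler_pM2l ?mulr_gt0// expR_gt0.
Qed.

End Reiteration.

(** * Return to the norms and spaces as stated *)

Lemma Lqnorm_tail_gt {R : realType} (q : \bar R) (b : R -> R) (t : R) : 0 < t ->
  Lqnorm q `]t, +oo[ (fun s => (s `^ (- rcp q) * b s)%:E) =
  mnorm q ((EFin \o b) \_ (tail_set positives t)).
Proof.
move=> t0; rewrite -tail_set_gt//; apply: Lqnorm_mnorm => // s.
by rewrite /= !in_itv/= !andbT; exact: lt_trans.
Qed.

Lemma Lqnorm_tail_lt {R : realType} (q : \bar R) (b : R -> R) (t : R) : 0 < t ->
  Lqnorm q `]0, t[ (fun s => (s `^ (- rcp q) * b s)%:E) =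
  mnorm q ((EFin \o b) \_ (tail_set negatives t)).
Proof.
move=> t0; rewrite -tail_set_lt//; apply: Lqnorm_mnorm => // s.
by rewrite /= !in_itv/= andbT => /andP[].
Qed.

(** The inequality between extended reals yields finiteness first, hence the inclusion; only then
    does it pass to the real-valued [qnorm]. *)
Lemma interp_embedded {R : realType} {V : topologicalLmodType R}
    (X0 X1 Z0 Z1 : qnspace R V) (s t : R) (q p : \bar R) (b g : R -> R) (C : R) :
  (forall f, carrier (interp X0 X1 s q b) f -> sum_carrier Z0 Z1 f /\
    (interp_norm Z0 Z1 t p g f <= C%:E * interp_norm X0 X1 s q b f)%E) ->
  qn_embedded (interp X0 X1 s q b) (interp Z0 Z1 t p g).
Proof.
move=> h.
have fin f : carrier (interp X0 X1 s q b) f -> carrier (interp Z0 Z1 t p g) f.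
  move=> cf; have [sf hf] := h f cf; split=> //.
  by apply: le_lt_trans hf _; rewrite -interp_qnormE// -EFinM ltry.
split=> //; exists C => f cf; have [_ hf] := h f cf.
by rewrite -lee_fin EFinM !interp_qnormE//; exact: fin.
Qed.

Theorem theorem20 (R : realType) (V : topologicalLmodType R)
  (A0 A1 : qnspace R V)
  (hA : compatible_couple A0 A1)
  (hA01 : exists2 f : V, carrier A0 f /\ carrier A1 f & f != 0)
  (theta theta1 : R)
  (htheta : 0 < theta < 1) (htheta1 : 0 < theta1 < 1)
  (q1 r0 r1 r : \bar R)
  (hq1 : (0 < q1)%E) (hr0 : (0 < r0)%E) (hr1 : (0 < r1)%E) (hr : (0 < r)%E)
  (a a1 b0 b1 : R -> R)
  (ha : slowly_varying a) (ha1 : slowly_varying a1)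
  (hb0 : slowly_varying b0) (hb1 : slowly_varying b1)
  (hfin1 : (Lqnorm r1 `]0%R, 1%R[
             (fun s => (s `^ (- rcp r1) * (b1 s / a1 s))%:E) < +oo)%E)
  (hfin0 : (Lqnorm r0 `]1%R, +oo[
             (fun s => (s `^ (- rcp r0) * b0 s)%:E) < +oo)%E) :
  let c0 := fun t : R =>
    fine (Lqnorm r0 `]t, +oo[ (fun s => (s `^ (- rcp r0) * b0 s)%:E)) in
  let c1 := fun t : R =>
    a1 t * fine (Lqnorm r1 `]0, t[
                   (fun s => (s `^ (- rcp r1) * (b1 s / a1 s))%:E)) in
  let rho := fun t : R => t `^ theta1 * (c0 t / c1 t) in
  let eta := theta * theta1 in
  let asharp := fun t : R =>
    c0 t `^ (1 - theta) * c1 t `^ theta * a (rho t) in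
  qn_equivalent
    (interp (interp A0 A1 0 r0 b0) (interpR A0 A1 theta1 r1 b1 q1 a1)
       theta r a)
    (interp A0 A1 eta r asharp).
Proof.
move=> c0 c1 rho eta asharp.
have sa := slowly_varying_slow ha; have sa1 := slowly_varying_slow ha1.
have sb0 := slowly_varying_slow hb0; have sb1 := slowly_varying_slow hb1.
pose h t := b1 t / a1 t; have sh : slow h by exact: slow_div.
(* c1 = a1 d1: only the factor d1 is a tail norm, to which [tail_slow] applies. *)
pose d1 := fun t : R => fine (Lqnorm r1 `]0, t[
  (fun s => (s `^ (- rcp r1) * (b1 s / a1 s))%:E)).
have [] := @tail_slow R r0 b0 positives 1 c0 hr0 sb0 shiftable_positives.
- by rewrite -Lqnorm_tail_gt.
- by move=> t t0; rewrite -Lqnorm_tail_gt.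
move=> sc0 mc0 bc0 amc0.
have [] := @tail_slow R r1 h negatives (- 1) d1 hr1 sh shiftable_negatives.
- by rewrite -Lqnorm_tail_lt.
- by move=> t t0; rewrite -Lqnorm_tail_lt.
move=> sd1 md1 bd1 amd1.
have [C C0 hC] := @embedding_into_asharp R V A0 A1 hA theta theta1 htheta1
  q1 r0 r1 r hq1 hr0 hr1 hr a a1 b0 b1 c0 d1 sa sa1 sb0 sb1 sc0 sd1 mc0 md1.
have [D D0 hD] := @embedding_of_asharp R V A0 A1 hA theta theta1 htheta htheta1
  q1 r0 r1 r hq1 hr0 hr1 hr a a1 b0 b1 c0 d1 sa sa1 sb0 sb1 sc0 sd1
  bc0 bd1 amc0 amd1.
split.
  by apply: (@interp_embedded _ _ _ _ _ _ _ _ _ _ _ _ C) => f [sf _]; exact: hC.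
by apply: (@interp_embedded _ _ _ _ _ _ _ _ _ _ _ _ D) => f [sf fin]; exact: hD.
Qed.
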